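(* Let $(T(t))_{t\ge0}$ be a bi-continuous semigroup of negative growth bound with generator $A$ on a triple $(X_0,\|\cdot\|,\tau)$ satisfying Assumption (S) of the context, and let $\alpha\in(0,1)$. Then the restricted operators $T_\alpha(t):=T(t)|_{X_\alpha}$ form a bi-continuous semigroup on $X_\alpha$ (with norm $\|\cdot\|_{F_\alpha}$ and topology $\tau_{F_\alpha}$). Moreover, the generator $A_\alpha$ of $(T_\alpha(t))_{t\ge0}$ is the part of $A$ in $X_\alpha$, i.e. $D(A_\alpha)=\{x\in D(A)\cap X_\alpha:Ax\in X_\alpha\}$ and $A_\alpha x=Ax$, and it is continuous with respect to $\tau_{F_\alpha}$ and $\tau_{F_{\alpha-1}}$, i.e. as a map from $(D(A_\alpha),\tau_{F_\alpha})$ to $(F_{\alpha-1},\tau_{F_{\alpha-1}})$.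
   Context: Assumption (S) on a triple $(X_0,\|\cdot\|,\tau)$: $(X_0,\|\cdot\|)$ is a Banach space; (1) $\tau$ is a locally convex Hausdorff topology coarser than the norm topology; (2) $\tau$ is sequentially complete on the closed unit ball; (3) $\|x\|=\sup\{|\varphi(x)|:\varphi\in(X_0,\tau)',\|\varphi\|\le1\}$. Equivalently to (3), there is a set $\mathcal{P}$ of $\tau$-continuous seminorms defining $\tau$ with $\|x\|=\sup_{p\in\mathcal{P}}p(x)$; fix such $\mathcal{P}$. A bi-continuous semigroup on such a triple is a family $(T(t))_{t\ge0}$ in $\mathscr{L}(X_0)$ with: $T(0)=I$, $T(t+s)=T(t)T(s)$; $t\mapsto T(t)x$ $\tau$-continuous for every $x$; $\|T(t)\|\le Me^{\omega t}$ for some $M\ge1$, $\omega\in\mathbb{R}$; and for each norm-bounded $\tau$-null sequence $(x_n)$ and $t_0\ge0$, $T(s)x_n\to0$ in $\tau$ uniformly for $s\in[0,t_0]$. Negative growth bound means that $\omega<0$ can be chosen (then $0\in\rho(A)$). Generator: $Ax:=\tau\text{-}\lim_{t\to0}\frac{T(t)x-x}{t}$, $D(A):=\{x:\tau\text{-}\lim_{t\to0}\frac{T(t)x-x}{t}\text{ exists and }\sup_{t\in(0,1]}\frac{\|T(t)x-x\|}{t}<\infty\}$. (The same definitions are used with $(X_\alpha,\|\cdot\|_{F_\alpha},\tau_{F_\alpha})$ in place of $(X_0,\|\cdot\|,\tau)$.) $F_\alpha:=\{x\in X_0:\|x\|_{F_\alpha}<\infty\}$ with $\|x\|_{F_\alpha}:=\sup_{t>0}\frac{\|T(t)x-x\|}{t^\alpha}$.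 $X_\alpha:=\{x\in F_\alpha:\tau\text{-}\lim_{t\to0}\frac{T(t)x-x}{t^\alpha}=0\}$ with the norm $\|\cdot\|_{F_\alpha}$. $\tau_{F_\alpha}$ is the locally convex topology on $F_\alpha$ (and $X_\alpha$) generated by the seminorms $p_{F_\alpha}(x):=\sup_{t>0}\frac{p(T(t)x-x)}{t^\alpha}$, $p\in\mathcal{P}$. Extrapolation. Let $\underline{X}_0:=\overline{D(A)}$ (norm closure). $\underline{X}_{-1}$ is the completion of $X_0$ for the norm $\|x\|_{\underline{X}_{-1}}:=\|A^{-1}x\|$, $\underline{A}_{-1}:\underline{X}_0\to\underline{X}_{-1}$ the unique continuous extension of $A:(D(A),\|\cdot\|)\to(X_0,\|\cdot\|_{\underline{X}_{-1}})$; $\underline{X}_{-2}$ is the completion of $\underline{X}_{-1}$ for $\|\underline{A}_{-1}^{-1}x\|_{\underline{X}_{-1}}$, and $\underline{A}_{-2}:\underline{X}_{-1}\to\underline{X}_{-2}$ the unique continuous extension of $\underline{A}_{-1}$ (both isometric isomorphisms). $X_{-1}:=\underline{A}_{-2}(X_0)$ with norm $\|\underline{A}_{-2}^{-1}x\|$; $X_0\subseteq X_{-1}$; $A_{-1}:X_0\to X_{-1}$ is the restriction of $\underline{A}_{-2}$, an isometric isomorphism extending $A$. Put $T_{-1}(t):=A_{-1}T(t)A_{-1}^{-1}$ and $p_{-1}(x):=p(A_{-1}^{-1}x)$ for $p\in\mathcal{P}$, $x\in X_{-1}$. Then $F_{\alpha-1}:=\{x\in X_{-1}:\sup_{t>0}\frac{\|T_{-1}(t)x-x\|_{X_{-1}}}{t^\alpha}<\infty\}$,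 with topology $\tau_{F_{\alpha-1}}$ generated by the seminorms $x\mapsto\sup_{t>0}\frac{p_{-1}(T_{-1}(t)x-x)}{t^\alpha}$, $p\in\mathcal{P}$. *)

(* Defs.v *)
From HB Require Import structures.
From mathcomp Require Import all_boot all_order all_algebra.
From mathcomp Require Import complex.
From mathcomp Require Import all_classical all_reals all_analysis.
Set Implicit Arguments.
Unset Strict Implicit.
Unset Printing Implicit Defensive.
Import Order.TTheory GRing.Theory Num.Theory.
Import numFieldNormedType.Exports.
Local Open Scope classical_set_scope.
Local Open Scope ring_scope.

(* Banach spaces are taken over the reals or over the complex numbers. *)
Inductive scalar_kind := RealScalars | ComplexScalars.

Definition scalars (R : realType) (k : scalar_kind) : numFieldType :=
  match k with RealScalars => R | ComplexScalars => R[i] end.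

Definition scalar_of_real (R : realType) (k : scalar_kind) :
    R -> scalars R k :=
  match k with
  | RealScalars => fun r => r
  | ComplexScalars => fun r => (r%:C)%C
  end.

Definition real_part (R : realType) (k : scalar_kind) : scalars R k -> R :=
  match k with
  | RealScalars => fun z => z
  | ComplexScalars => fun z => complex.Re z
  end.

(* In the library, absolute values and norms over R[i] lie in R[i]. *)
Definition scalar_abs (R : realType) (k : scalar_kind) (z : scalars R k) : R :=
  real_part `|z|.

Definition real_norm (R : realType) (k : scalar_kind)
    (X : normedModType (scalars R k)) (x : X) : R :=
  real_part `|x|.

(* A triple (X, ||.||, tau) lives on a subspace X = carrier of an ambient
   vector space V, so that X_alpha can be compared with X_0 without changing
   types. The norm is only relevant on the carrier, and tau is the family of
   the open subsets of the carrier. *)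
Record triple (R : realType) (k : scalar_kind) (V : lmodType (scalars R k)) :=
  Triple {
    carrier : set V;
    nrm : V -> R;
    tau : set (set V)
  }.

Section LocallyConvex.
Variables (R : realType) (k : scalar_kind) (V : lmodType (scalars R k)).
Implicit Types (D : set V) (tau : set (set V)) (P : set (V -> R)).

Definition subspace_of D : Prop :=
  D 0 /\ forall (a : scalars R k) x y, D x -> D y -> D (a *: x + y).

Definition seminorm_on D (p : V -> R) : Prop :=
  [/\ forall x, D x -> 0 <= p x,
      forall x y, D x -> D y -> p (x + y) <= p x + p y
    & forall (a : scalars R k) x, D x -> p (a *: x) = scalar_abs a * p x].

Definition norm_on D (p : V -> R) : Prop :=
  seminorm_on D p /\ forall x, D x -> p x = 0 -> x = 0.

Definition seminorm_topology D P : set (set V) :=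
  [set U | U `<=` D /\
    forall x, U x -> exists (n : nat) (p : 'I_n -> V -> R) (eps : R),
      [/\ forall i, P (p i), 0 < eps
        & forall y, D y -> (forall i, p i (y - x) < eps) -> U y]].

Definition defines_topology D P tau : Prop :=
  (forall p, P p -> seminorm_on D p) /\ tau = seminorm_topology D P.

Definition tnbhs tau (x : V) : set_system V :=
  [set N | exists2 U, tau U & U x /\ U `<=` N].

Definition linear_on (W : lmodType (scalars R k)) D (f : V -> W) : Prop :=
  forall (a : scalars R k) x y, D x -> D y -> f (a *: x + y) = a *: f x + f y.

End LocallyConvex.

Section Triples.
Variables (R : realType) (k : scalar_kind) (V : lmodType (scalars R k)).
Variable X : triple V.

Definition norm_complete : Prop :=
  forall u : nat -> V, (forall n, carrier X (u n)) ->
    (forall eps : R, 0 < eps -> exists N : nat, forall m n : nat,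
       (N <= m)%N -> (N <= n)%N -> nrm X (u m - u n) < eps) ->
    exists2 l, carrier X l & (fun n => nrm X (u n - l)) @ \oo --> (0 : R).

Definition hausdorff_tau : Prop :=
  forall x y, carrier X x -> carrier X y -> x <> y ->
    exists U W, [/\ tau X U, tau X W, U x, W y & U `&` W = set0].

Definition unit_ball : set V := [set x | carrier X x /\ nrm X x <= 1].

Definition tau_cauchy (u : nat -> V) : Prop :=
  forall U, tau X U -> U 0 -> exists N : nat, forall m n : nat,
    (N <= m)%N -> (N <= n)%N -> U (u m - u n).

Definition seq_complete_on_ball : Prop :=
  forall u : nat -> V, (forall n, unit_ball (u n)) -> tau_cauchy u ->
    exists2 l, unit_ball l & u @ \oo `=>` tnbhs (tau X) l.

Definition dual_unit_ball : set (V -> scalars R k) :=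
  [set phi |
    [/\ forall (a : scalars R k) x y, carrier X x -> carrier X y ->
          phi (a *: x + y) = a * phi x + phi y,
        forall x, carrier X x -> phi @ tnbhs (tau X) x --> phi x
      & forall x, carrier X x -> scalar_abs (phi x) <= nrm X x]].

Record assumption_S : Prop := AssumptionS {
  S_subspace : subspace_of (carrier X);
  S_norm : norm_on (carrier X) (nrm X);
  S_banach : norm_complete;
  S_locally_convex : exists P, defines_topology (carrier X) P (tau X);
  S_hausdorff : hausdorff_tau;
  S_coarser : tau X `<=` seminorm_topology (carrier X) [set nrm X];
  S_seq_complete : seq_complete_on_ball;
  S_norming : forall x, carrier X x ->
    (nrm X x)%:E = ereal_sup [set (scalar_abs (phi x))%:E | phi in dual_unit_ball]
}.

Definition norming_seminorms (P : set (V -> R)) : Prop :=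
  defines_topology (carrier X) P (tau X) /\
  forall x, carrier X x -> (nrm X x)%:E = ereal_sup [set (p x)%:E | p in P].

Variable T : R -> V -> V.

Definition exp_bounded (M omega : R) : Prop :=
  forall (t : R) x, 0 <= t -> carrier X x ->
    nrm X (T t x) <= M * expR (omega * t) * nrm X x.

(* Boundedness of each T t is part of bc_exp_bounded. *)
Record bicontinuous_semigroup : Prop := BicontinuousSemigroup {
  bc_maps : forall (t : R) x, 0 <= t -> carrier X x -> carrier X (T t x);
  bc_linear : forall t : R, 0 <= t -> linear_on (carrier X) (T t);
  bc_zero : forall x, carrier X x -> T 0 x = x;
  bc_add : forall (t s : R) x, 0 <= t -> 0 <= s -> carrier X x ->
    T (t + s) x = T t (T s x);
  bc_continuous : forall x (t : R), carrier X x -> 0 <= t ->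
    (fun s : R => T s x) @ within [set s : R | 0 <= s] (nbhs t)
      `=>` tnbhs (tau X) (T t x);
  bc_exp_bounded : exists M omega : R, 1 <= M /\ exp_bounded M omega;
  bc_equicontinuous : forall (u : nat -> V) (t0 : R), 0 <= t0 ->
    (forall n, carrier X (u n)) ->
    (exists C : R, forall n, nrm X (u n) <= C) ->
    u @ \oo `=>` tnbhs (tau X) 0 ->
    forall U, tau X U -> U 0 ->
      \forall n \near \oo, forall s : R, 0 <= s <= t0 -> U (T s (u n))
}.

Definition negative_growth_bound : Prop :=
  exists M omega : R, [/\ 1 <= M, omega < 0 & exp_bounded M omega].

Definition is_gen_value (x y : V) : Prop :=
  carrier X y /\
  (fun t : R => scalar_of_real k t^-1 *: (T t x - x)) @ 0^'+ `=>` tnbhs (tau X) y.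

Definition gen_dom : set V :=
  [set x | [/\ carrier X x, exists y, is_gen_value x y
    & (ereal_sup [set (nrm X (T t x - x) / t)%:E | t in [set t : R | (0 < t <= 1)%R]]
       < +oo)%E]].

Definition gen (x : V) : V := xget 0 (is_gen_value x).

End Triples.

Definition holder_sup (R : realType) (k : scalar_kind)
    (V : lmodType (scalars R k)) (T : R -> V -> V) (alpha : R) (q : V -> R)
    (x : V) : \bar R :=
  ereal_sup [set (q (T t x - x) / t `^ alpha)%:E | t in [set t : R | 0 < t]].

Definition holder_seminorm (R : realType) (k : scalar_kind)
    (V : lmodType (scalars R k)) (T : R -> V -> V) (alpha : R) (q : V -> R)
    (x : V) : R :=
  fine (holder_sup T alpha q x).

Section FavardHolder.
Variables (R : realType) (k : scalar_kind) (V : lmodType (scalars R k)).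
Variables (X : triple V) (P : set (V -> R)) (T : R -> V -> V) (alpha : R).

Definition F_space : set V :=
  [set x | carrier X x /\ (holder_sup T alpha (nrm X) x < +oo)%E].

Definition X_space : set V :=
  [set x | F_space x /\
    (fun t : R => scalar_of_real k (t `^ alpha)^-1 *: (T t x - x)) @ 0^'+
      `=>` tnbhs (tau X) 0].

Definition holder_triple : triple V :=
  {| carrier := X_space;
     nrm := holder_seminorm T alpha (nrm X);
     tau := seminorm_topology X_space
              [set holder_seminorm T alpha p | p in P] |}.

End FavardHolder.

(* A completion of a normed space is a Banach space together with a linear
   isometry of dense range. The norm of ext1 is ||A^-1 x||, that of ext2 is
   ||ext_A1^-1 x||; ext_A1 and ext_A2 are the continuous extensions of A, the
   former being meaningful on the closure of D only. *)
Record extrapolation (R : realType) (k : scalar_kind)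
    (X0 : completeNormedModType (scalars R k)) (D : set X0) (A : X0 -> X0) :=
  Extrapolation {
    ext1 : completeNormedModType (scalars R k);
    ext_j1 : {linear X0 -> ext1};
    ext_j1_norm : forall x, `|ext_j1 x| = `|'pinv_(fun=> 0) D A x|;
    ext_j1_dense : dense (range ext_j1);
    ext_A1 : X0 -> ext1;
    ext_A1_extends : forall x, D x -> ext_A1 x = ext_j1 (A x);
    ext_A1_continuous : {within closure D, continuous ext_A1};
    ext2 : completeNormedModType (scalars R k);
    ext_j2 : {linear ext1 -> ext2};
    ext_j2_norm : forall x,
      `|ext_j2 x| = `|ext_j1 ('pinv_(fun=> 0) (closure D) ext_A1 x)|;
    ext_j2_dense : dense (range ext_j2);
    ext_A2 : ext1 -> ext2;
    ext_A2_extends : forall x, closure D x -> ext_A2 (ext_j1 x) = ext_j2 (ext_A1 x);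
    ext_A2_continuous : continuous ext_A2
  }.
Arguments ext_j1 {R k X0 D A} e.
Arguments ext_j2 {R k X0 D A} e.
Arguments ext_A1 {R k X0 D A} e x.
Arguments ext_A2 {R k X0 D A} e x.

Section Extrapolation.
Variables (R : realType) (k : scalar_kind).
Variables (X0 : completeNormedModType (scalars R k)).
Variables (D : set X0) (A : X0 -> X0) (E : extrapolation D A).
Variables (P : set (X0 -> R)) (T : R -> X0 -> X0) (alpha : R).

Definition ext_incl (x : X0) : ext2 E := ext_j2 E (ext_j1 E x).

Definition A_m1 (x : X0) : ext2 E := ext_A2 E (ext_j1 E x).

Definition X_m1 : set (ext2 E) := range A_m1.

Definition A_m1_inv : ext2 E -> X0 := 'pinv_(fun=> 0) setT A_m1.

Definition nrm_m1 (x : ext2 E) : R := real_norm (A_m1_inv x).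

Definition T_m1 (t : R) (x : ext2 E) : ext2 E := A_m1 (T t (A_m1_inv x)).

Definition F_m1 : set (ext2 E) :=
  [set x | X_m1 x /\ (holder_sup T_m1 alpha nrm_m1 x < +oo)%E].

Definition tau_F_m1 : set (set (ext2 E)) :=
  seminorm_topology F_m1
    [set holder_seminorm T_m1 alpha (p \o A_m1_inv) | p in P].

End Extrapolation.
Arguments ext_incl {R k X0 D A} E x.
Arguments A_m1 {R k X0 D A} E x.
Arguments X_m1 {R k X0 D A} E _.
Arguments A_m1_inv {R k X0 D A} E _.
Arguments nrm_m1 {R k X0 D A} E x.
Arguments T_m1 {R k X0 D A} E T t x.
Arguments F_m1 {R k X0 D A} E T alpha _.
Arguments tau_F_m1 {R k X0 D A} E P T alpha _.

Definition continuous_between (R : realType) (k : scalar_kind)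
    (V W : lmodType (scalars R k)) (D : set V) (tauV : set (set V))
    (tauW : set (set W)) (f : V -> W) : Prop :=
  forall U, tauW U -> exists2 O, tauV O & D `&` f @^-1` U = D `&` O.

(* Main.v *)
Require Import Defs.
From HB Require Import structures.
From mathcomp Require Import all_boot all_order all_algebra.
From mathcomp Require Import complex.
From mathcomp Require Import all_classical all_reals all_analysis.
From mathcomp Require Import ring lra.
Set Implicit Arguments.
Unset Strict Implicit.
Unset Printing Implicit Defensive.
Import Order.TTheory GRing.Theory Num.Theory.
Import numFieldNormedType.Exports.
Local Open Scope classical_set_scope.
Local Open Scope ring_scope.

(** On the Hoelder space, T(t) commutes with the quotients (T(h) - 1) / h^alpha, so
  every seminorm of tau_F is a supremum over h of tau-seminorms of such quotients and
  statements about T on X_alpha reduce to tau-equicontinuity of T, uniformly in h.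
  The functionals phi o (T(h) - 1) / h^alpha, which are tau_F-continuous even though T(h)
  is not tau-continuous, norm X_alpha.  On norm-bounded sets tau_F is finer than tau,
  because T(t) decays.  For the generator, a mean value inequality applied to
  (T(h) - 1) (T(t) x - x - t A x) bounds its tau-seminorms by
  t sup_(s <= t) p ((T(h) - 1) (T(s) A x - A x)), which replaces vector-valued integrals
  and yields convergence of the difference quotients in tau_F.

  For the continuity statement, A_-1 is an isometric linear bijection that extends A and
  intertwines T with T_-1, so it is an isomorphism of Hoelder seminorms; A_alpha is its
  restriction.  That A_-1 is injective and linear follows by density from the same
  properties of A on D(A): A is onto by a Neumann series for 1 - T(t), and D(A) is dense
  for the extrapolated norm since A y = lim (T(t) y - y) / t in that norm. *)

(** The operators T(t) need not be tau-continuous: bi-continuity controls only norm-bounded tau-null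
    sequences. So whenever T is applied to a tau-limit, the limit runs along a filter with a
    countable base and comes with a norm bound. For difference quotients in D(A) this bound is the
    second clause in the definition of the domain. The suprema run over all t > 0, hence large t
    needs an argument of its own, and this is where the negative growth bound enters.

    The generator yields right derivatives, so the mean value inequality asks for no more than these
    and left continuity. One integral remains, that of an orbit over [0, t]: it produces the
    elements of D(A) from which the surjectivity of A is derived. Surjectivity matters because an
    [extrapolation] describes its norms through a pseudo-inverse of A and its extensions by
    continuity alone, so that bijectivity and linearity have to be recovered. *)

Section Scalars.
Variables (R : realType) (k : scalar_kind).
Local Notation K := (scalars R k).

Lemma scalar_of_real_zmod_morphism : zmod_morphism (@scalar_of_real R k).
Proof. by case: k => //= x y; exact: rmorphB. Qed.

Lemma scalar_of_real_monoid_morphism : monoid_morphism (@scalar_of_real R k).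
Proof. by case: k; split => //= x y; exact: rmorphM. Qed.

HB.instance Definition _ := GRing.isZmodMorphism.Build R K
  (@scalar_of_real R k) scalar_of_real_zmod_morphism.
HB.instance Definition _ := GRing.isMonoidMorphism.Build R K
  (@scalar_of_real R k) scalar_of_real_monoid_morphism.

Lemma scalar_abs_real (r : R) : scalar_abs (scalar_of_real k r) = `|r|.
Proof.
case: k => //; have /(congr1 (@complex.Re R)) := normc_def (r%:C)%C.
by rewrite /= expr0n /= addr0 sqrtr_sqr.
Qed.

Lemma scalar_abs_ge0 (z : K) : 0 <= scalar_abs z.
Proof.
case: k z => /= z; first exact: normr_ge0.
by have := normr_ge0 (z : R[i]); rewrite lecE => /andP[].
Qed.

Lemma scalar_of_realK (z : K) : 0 <= z -> scalar_of_real k (real_part z) = z.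
Proof. by case: k z => //= z /ger0_real; exact: RRe_real. Qed.

Lemma ltr_scalar_of_real (r s : R) :
  (scalar_of_real k r < scalar_of_real k s) = (r < s).
Proof. by case: k => //=; exact: ltcR. Qed.

Lemma normr_real_norm (X : normedModType K) (x : X) :
  `|x| = scalar_of_real k (real_norm x).
Proof. by rewrite scalar_of_realK. Qed.

End Scalars.

Lemma subrACA (V : zmodType) (a b c d : V) : (a - b) - (c - d) = (a - c) - (b - d).
Proof. by rewrite opprD addrACA -opprD. Qed.

(** * Topologies defined by seminorms *)

Section SeminormTopology.
Variables (R : realType) (k : scalar_kind) (V : lmodType (scalars R k)).
Local Notation sor := (@scalar_of_real R k).

Section Subspace.
Variable D : set V.
Hypothesis Dsub : subspace_of D.

Lemma subspace0 : D 0. Proof. by case: Dsub. Qed.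
Lemma subspaceD x y : D x -> D y -> D (x + y).
Proof. by move=> Dx Dy; rewrite -[x]scale1r; apply: Dsub.2. Qed.
Lemma subspaceZ a x : D x -> D (a *: x).
Proof. by move=> Dx; rewrite -[_ *: _]addr0; apply: Dsub.2 => //; exact: subspace0. Qed.
Lemma subspaceN x : D x -> D (- x).
Proof. by move=> Dx; rewrite -scaleN1r; exact: subspaceZ. Qed.
Lemma subspaceB x y : D x -> D y -> D (x - y).
Proof. by move=> Dx Dy; apply: subspaceD => //; exact: subspaceN. Qed.

Variable p : V -> R.
Hypothesis psn : seminorm_on D p.

Lemma seminorm_ge0 x : D x -> 0 <= p x. Proof. by case: psn => + _ _; apply. Qed.
Lemma seminormZ a x : D x -> p (a *: x) = scalar_abs a * p x.
Proof. by case: psn => _ _ +; apply. Qed.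
Lemma seminormZr (r : R) x : D x -> p (sor r *: x) = `|r| * p x.
Proof. by move=> Dx; rewrite seminormZ // scalar_abs_real. Qed.
Lemma seminorm0 : p 0 = 0.
Proof. by rewrite -(scale0r 0) -(rmorph0 sor) seminormZr ?normr0 ?mul0r//; exact: subspace0. Qed.
Lemma seminormN x : D x -> p (- x) = p x.
Proof. by move=> Dx; rewrite -scaleN1r -(rmorphN1 sor) seminormZr// normrN1 mul1r. Qed.
Lemma seminormD x y : D x -> D y -> p (x + y) <= p x + p y.
Proof. by case: psn => _ + _; apply. Qed.
Lemma seminormB x y : D x -> D y -> p (x - y) <= p x + p y.
Proof. by move=> Dx Dy; rewrite -(seminormN Dy); apply: seminormD => //; exact: subspaceN. Qed.
Lemma seminormBC x y : D x -> D y -> p (x - y) = p (y - x).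
Proof. by move=> Dx Dy; rewrite -opprB seminormN//; exact: subspaceB. Qed.
Lemma seminorm_tri z x y : D x -> D y -> D z -> p (x - y) <= p (x - z) + p (z - y).
Proof.
move=> Dx Dy Dz; rewrite [x - y](_ : _ = (x - z) + (z - y)); last by rewrite addrA subrK.
by apply: seminormD; exact: subspaceB.
Qed.

End Subspace.

Section Topology.
Variables (D : set V) (P : set (V -> R)).
Hypotheses (Dsub : subspace_of D) (Psn : forall p, P p -> seminorm_on D p).
Local Notation tauP := (seminorm_topology D P).

Lemma seminorm_ball_open p x e : P p -> D x ->
  tauP [set y | D y /\ p (y - x) < e].
Proof.
move=> Pp Dx; split=> [y []//|y [Dy pyx]].
exists 1%N, (fun=> p), (e - p (y - x)); split => //; first by rewrite subr_gt0.
move=> z Dz /(_ ord0); rewrite ltrBrDr => h; split => //.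
by apply: le_lt_trans h; apply: (seminorm_tri Dsub (Psn Pp)).
Qed.

Lemma seminorm_cvgP (I : Type) (F : set_system I) (f : I -> V) l :
  Filter F -> D l -> (\forall i \near F, D (f i)) ->
  (f @ F `=>` tnbhs tauP l <->
   forall p, P p -> forall e, 0 < e -> \forall i \near F, p (f i - l) < e).
Proof.
move=> FF Dl Df; split=> [fl p Pp e e0|H N [U [UD Uo] [Ul UN]]].
  have := fl [set y | D y /\ p (y - l) < e].
  have h : tnbhs tauP l [set y | D y /\ p (y - l) < e].
    exists [set y | D y /\ p (y - l) < e] => //; first exact: seminorm_ball_open.
    split => //=; split => //.
    by rewrite subrr (seminorm0 Dsub (Psn Pp)).
  by move=> /(_ h); rewrite /nbhs /=; apply: filterS => i [].
have [n [p [e [Pp e0 H1]]]] := Uo l Ul.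
have Hall : \forall i \near F, forall j : 'I_n, p j (f i - l) < e.
  by apply: filter_forall => j; apply: H => //.
rewrite /nbhs /=; near=> i; apply: UN; apply: H1; first by near: i.
by near: i.
Unshelve. all: by end_near. Qed.

Lemma seminorm_hausdorff :
  (forall x, D x -> (forall p, P p -> p x = 0) -> x = 0) ->
  forall x y, D x -> D y -> x <> y ->
    exists U W, [/\ tauP U, tauP W, U x, W y & U `&` W = set0].
Proof.
move=> sep x y Dx Dy xy.
have Dxy : D (x - y) by exact: subspaceB.
have [p Pp pxy] : exists2 p, P p & p (x - y) <> 0.
  apply: contrapT => nP; apply: xy; apply/eqP; rewrite -subr_eq0; apply/eqP.
  by apply: sep => // p Pp; apply: contrapT => h; apply: nP; exists p.
have p0 : 0 < p (x - y).
  by rewrite lt_def (seminorm_ge0 (Psn Pp))// andbT; exact/eqP.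
exists [set z | D z /\ p (z - x) < p (x - y) / 2].
exists [set z | D z /\ p (z - y) < p (x - y) / 2].
have self z : D z -> p (z - z) < p (x - y) / 2.
  by move=> Dz; rewrite subrr (seminorm0 Dsub (Psn Pp)) divr_gt0.
split; [exact: seminorm_ball_open|exact: seminorm_ball_open|by split; auto|by split; auto|].
apply/seteqP; split => // z [[Dz zx] [_ zy]].
have := seminorm_tri Dsub (Psn Pp) Dx Dy Dz.
rewrite (seminormBC Dsub (Psn Pp) Dx Dz); lra.
Qed.

End Topology.

(* The set of times s <= t with p (g s - g 0) <= (L + e) s is closed from the left
   and open from the right, so it contains t. *)
Lemma seminorm_mean_value (p : V -> R) (g : R -> V) (L t : R) :
  seminorm_on setT p -> 0 <= t ->
  (forall s e, 0 < s <= t -> 0 < e ->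
     exists2 d, 0 < d & forall s', 0 <= s' -> s - d < s' <= s -> p (g s - g s') <= e) ->
  (forall s e, 0 <= s < t -> 0 < e ->
     \forall r \near 0^'+, p (g (s + r) - g s) <= (L + e) * r) ->
  p (g t - g 0) <= L * t.
Proof.
move=> psn t0 lc rd.
have VT : subspace_of (@setT V) by split.
apply/ler_addgt0Pr => e' e'0.
(* Spreads the slack e' over [0, t]; [1 + t] in place of t covers t = 0. *)
pose e := e' / (1 + t).
have e0 : 0 < e by rewrite divr_gt0//; lra.
have et : e * t <= e'.
  by rewrite /e mulrAC ler_pdivrMr; nra.
suff : p (g t - g 0) <= (L + e) * t by nra.
pose S := [set s | 0 <= s <= t /\ p (g s - g 0) <= (L + e) * s].
have S0 : S 0 by split; [rewrite lexx t0|rewrite subrr (seminorm0 VT psn) mulr0].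
have Sub : has_ubound S by exists t => s [] /andP[].
have Ssup : has_sup S by split=> //; exists 0.
pose c := sup S.
have c0 : 0 <= c by apply: ub_le_sup.
have ct : c <= t by apply: ge_sup; [exists 0|move=> s [] /andP[]].
have Sc : S c.
  split; first by rewrite c0 ct.
  have [->|cn0] := eqVneq c 0; first by case: S0.
  have cgt0 : 0 < c by rewrite lt_def cn0.
  apply/ler_addgt0Pr => d d0.
  have [||d1 d10 hd1] := lc c (d / 2); rewrite ?cgt0//; first lra.
  (* This step length costs at most d / 2 in [(L + e) * (s - c)], whatever the sign of L + e. *)
  pose m := Num.min d1 (d / (2 * (`|L + e| + 1))).
  have L1 : 0 < `|L + e| + 1 by rewrite ltr_wpDl.
  have m0 : 0 < m by rewrite lt_min d10 /= divr_gt0// mulr_gt0.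
  have [s Ss cs] := sup_adherent m0 Ssup.
  have sc : s <= c by apply: ub_le_sup.
  case: Ss => /andP[s0 st] ps.
  have h1 : p (g c - g s) <= d / 2.
    apply: hd1 => //; rewrite sc andbT.
    by apply: le_lt_trans cs; rewrite lerD2l lerN2 ge_min lexx.
  have h2 : p (g c - g 0) <= p (g c - g s) + p (g s - g 0) by apply: (seminorm_tri VT psn).
  have h3 : (L + e) * s <= (L + e) * c + d / 2.
    have : (L + e) * (s - c) <= d / 2.
      apply: le_trans (ler_norm _) _; rewrite normrM distrC (ger0_norm (x := c - s)) ?subr_ge0//.
      have cm : c - s <= d / (2 * (`|L + e| + 1)).
        have : c - s <= m by rewrite lerBlDr -lerBlDl ltW.
        by rewrite /m le_min => /andP[].
      apply: (@le_trans _ _ ((`|L + e| + 1) * (c - s))).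
        by rewrite ler_wpM2r ?subr_ge0//; lra.
      apply: (@le_trans _ _ ((`|L + e| + 1) * (d / (2 * (`|L + e| + 1))))).
        by rewrite ler_wpM2l// ltW.
      by rewrite le_eqVlt; apply/orP; left; apply/eqP; field; rewrite gt_eqF.
    lra.
  lra.
suff -> : t = c by case: Sc.
apply/eqP; rewrite eq_le ct andbT leNgt; apply/negP => clt.
have hr := rd c e; rewrite c0 clt in hr.
have {}hr := hr isT e0.
have : \forall r \near (0 : R)^'+, False.
  have lt1 : \forall r \near (0:R)^'+, r < t - c.
    by apply: nbhs_right_lt; rewrite subr_gt0.
  have gt0 : \forall r \near (0:R)^'+, 0 < r by exact: nbhs_right_gt.
  near=> r.
  have r0 : 0 < r by near: r.
  have rlt : r < t - c by near: r.
  have pr : p (g (c + r) - g c) <= (L + e) * r by near: r.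
  have : S (c + r).
    split; first by apply/andP; split; lra.
    have h2 := seminorm_tri VT psn (x := g (c + r)) (y := g 0) (z := g c) I I I.
    case: Sc => _ h3; rewrite mulrDr; lra.
  move=> /(ub_le_sup Sub); rewrite -/c; lra.
by move=> /filter_ex[].
Unshelve. all: by end_near. Qed.

(** A Lipschitz bound supplies the left continuity. The Lipschitz constant L does not enter the
    conclusion, which depends on the right derivative alone. *)
Lemma seminorm_mean_value_lipschitz (p : V -> R) (g : R -> V) (L K t : R) :
  seminorm_on setT p -> 0 <= t ->
  (forall s s', 0 <= s' -> s' <= s -> p (g s - g s') <= L * (s - s')) ->
  (forall s e, 0 <= s < t -> 0 < e ->
     \forall r \near 0^'+, p (g (s + r) - g s) <= (K + e) * r) ->
  p (g t - g 0) <= K * t.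
Proof.
move=> psn t0 lip rd; apply: (@seminorm_mean_value p g K t) => // s e _ e0.
have L1 : 0 < `|L| + 1 by rewrite ltr_wpDl.
exists (e / (`|L| + 1)); first by rewrite divr_gt0.
move=> s' s'0 /andP[ss' s's]; apply: le_trans (lip _ _ s'0 s's) _.
have ss0 : 0 <= s - s' by rewrite subr_ge0.
apply: (@le_trans _ _ ((`|L| + 1) * (s - s'))).
  by rewrite ler_wpM2r// (le_trans (ler_norm L))// lerDl.
by rewrite -ler_pdivlMl// mulrC lerBlDr -lerBlDl ltW.
Qed.

End SeminormTopology.

(** * Suprema of Hoelder quotients *)

Section HolderSup.
Variables (R : realType) (k : scalar_kind) (V : lmodType (scalars R k)).
Variables (T : R -> V -> V) (alpha : R) (q : V -> R) (x : V).

(** [fine] sends +oo to 0, hence the finiteness hypothesis. *)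
Lemma holder_seminorm_ge t : (holder_sup T alpha q x < +oo)%E -> 0 < t ->
  q (T t x - x) / t `^ alpha <= holder_seminorm T alpha q x.
Proof.
move=> fin t0; rewrite /holder_seminorm.
have le s : 0 < s -> ((q (T s x - x) / s `^ alpha)%:E <= holder_sup T alpha q x)%E.
  by move=> s0; apply: ereal_sup_ubound; exists s.
rewrite -lee_fin fineK; first exact: le.
by rewrite fin_numElt fin andbT (lt_le_trans _ (le _ t0))// ltNyr.
Qed.

Lemma holder_sup_lty C :
  (forall t, 0 < t -> q (T t x - x) / t `^ alpha <= C) ->
  (holder_sup T alpha q x < +oo)%E.
Proof.
move=> h; apply: le_lt_trans (ltry C); apply: ge_ereal_sup => _ [t t0 <-].
by rewrite lee_fin h.
Qed.

Lemma holder_seminorm_le C :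
  (forall t, 0 < t -> q (T t x - x) / t `^ alpha <= C) ->
  holder_seminorm T alpha q x <= C.
Proof.
move=> h; have fin := holder_sup_lty h.
rewrite -lee_fin fineK.
  by apply: ge_ereal_sup => _ [t t0 <-]; rewrite lee_fin h.
(* The sample at t = 1 keeps the supremum above -oo, where [fine] would return 0. *)
rewrite fin_numElt fin andbT; apply: (@lt_le_trans _ _ (q (T 1 x - x) / 1 `^ alpha)%:E).
  exact: ltNyr.
by apply: ereal_sup_ubound; exists 1 => //=.
Qed.

End HolderSup.

(** * Filters with a countable base *)

Section CountableBase.
Variable R : realType.

(** Since [B n] lies in U for all large n, any choice of one point in each [B n] is a sequence that
    tends to F, and B need not be decreasing. *)
Definition countably_based (I : Type) (F : set_system I) : Prop :=
  exists B : nat -> set I, (forall n, F (B n)) /\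
    forall U, F U -> exists m, forall n, (m <= n)%N -> B n `<=` U.

Lemma countably_based_eventually : countably_based \oo.
Proof.
exists (fun n => [set m | (n <= m)%N]); split=> [n|U [m _ mU]]; first by exists n.
by exists m => n mn j /= nj; apply: mU => /=; exact: leq_trans nj.
Qed.

Lemma near_invSn (e : R) : 0 < e -> exists m, forall n, (m <= n)%N -> n.+1%:R^-1 < e.
Proof.
move=> e0; have [m _ h] := near_infty_natSinv_lt (PosNum e0).
by exists m => n mn; apply: h.
Qed.

Lemma countably_based_right0 : countably_based (0 : R)^'+.
Proof.
exists (fun n => [set r : R | 0 < r < n.+1%:R^-1]); split=> [n|U].
  near=> r; apply/andP; split; first by near: r; exact: nbhs_right_gt.
  by near: r; apply: nbhs_right_lt.
rewrite /at_right /within /= => /nbhs_ballP[e /= e0 eU].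
have [m hm] := near_invSn e0.
exists m => n mn r /= /andP[r0 rn]; apply: eU => //.
by rewrite /ball /= sub0r normrN gtr0_norm// (lt_trans rn)// hm.
Unshelve. all: by end_near. Qed.

Lemma countably_based_within (D : set R) (t : R) : countably_based (within D (nbhs t)).
Proof.
exists (fun n => [set r : R | D r /\ `|t - r| < n.+1%:R^-1]); split=> [n|U].
  rewrite /within /=; apply/nbhs_ballP; exists n.+1%:R^-1.
    by rewrite /= invr_gt0.
  by move=> r tr Dr; split.
rewrite /within /= => /nbhs_ballP[e /= e0 eU].
have [m hm] := near_invSn e0.
exists m => n mn r /= [Dr rn]; apply: eU => //.
by rewrite /ball /= (lt_trans rn)// hm.
Qed.

End CountableBase.

(** * Bi-continuous semigroups: decay and equicontinuity *)

Section Semigroup.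
Variables (R : realType) (k : scalar_kind) (V : lmodType (scalars R k)).
Variables (N : V -> R) (tau0 : set (set V)) (P : set (V -> R)) (T : R -> V -> V).
Local Notation X := (Triple (@setT V) N tau0).
Hypotheses (hS : assumption_S X) (hP : norming_seminorms X P).
Hypothesis hT : bicontinuous_semigroup X T.
Variables (M w : R).
Hypotheses (M1 : 1 <= M) (w0 : w < 0) (hexp : exp_bounded X T M w).
Local Notation sor := (@scalar_of_real R k).

Lemma subspace_setT : subspace_of (@setT V). Proof. by []. Qed.
Local Notation VT := subspace_setT.

(** Covers both [N] and, as P is norming, every p in P, so that facts about Hoelder seminorms are
    proved once for the norm and the topology. *)
Definition dominated (p : V -> R) := seminorm_on setT p /\ forall x, p x <= N x.

Lemma dominated_norm : dominated N.
Proof. by split=> //; exact: (S_norm hS).1. Qed.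
Local Notation dN := dominated_norm.

Lemma dominated_P p : P p -> dominated p.
Proof.
move=> Pp; split; first exact: hP.1.1.
by move=> x; rewrite -lee_fin (hP.2 x I); apply: ereal_sup_ubound; exists p.
Qed.

Lemma norm_le_P x C : (forall p, P p -> p x <= C) -> N x <= C.
Proof.
move=> h; rewrite -lee_fin (hP.2 x I); apply: ge_ereal_sup => _ [p Pp <-].
by rewrite lee_fin h.
Qed.

Lemma norm_eq0 x : N x = 0 -> x = 0. Proof. exact: (S_norm hS).2. Qed.

Lemma norm_ge0 x : 0 <= N x. Proof. exact: (seminorm_ge0 dN.1). Qed.

Lemma P_separates x : (forall p, P p -> p x = 0) -> x = 0.
Proof.
move=> h; apply: norm_eq0; apply/eqP; rewrite eq_le norm_ge0 andbT.
by apply: norm_le_P => p Pp; rewrite h.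
Qed.

Lemma cvg_tauP (I : Type) (F : set_system I) (f : I -> V) l : Filter F ->
  (f @ F `=>` tnbhs tau0 l <->
   forall p, P p -> forall e, 0 < e -> \forall i \near F, p (f i - l) < e).
Proof.
move=> FF; rewrite (hP.1.2 : tau0 = _); apply: (seminorm_cvgP VT) => //.
  exact: hP.1.1.
exact: nearW.
Qed.

Lemma tau_open_seminorms U x : tau0 U -> U x ->
  exists (n : nat) (p : 'I_n -> V -> R) (e : R),
    [/\ forall i, P (p i), 0 < e & forall y, (forall i, p i (y - x) < e) -> U y].
Proof.
rewrite (hP.1.2 : tau0 = _) => -[_ Uo] /Uo[n [p [e [Pp e0 pU]]]].
by exists n, p, e; split => // y; exact: pU.
Qed.

Lemma semigroupD t x y : 0 <= t -> T t (x + y) = T t x + T t y.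
Proof. by move=> t0; have := bc_linear hT t0 1 (x := x) (y := y) I I; rewrite !scale1r. Qed.
Lemma semigroup0 t : 0 <= t -> T t 0 = 0.
Proof. by move=> t0; apply: (@addrI _ (T t 0)); rewrite -semigroupD// !addr0. Qed.
Lemma semigroupZ t a x : 0 <= t -> T t (a *: x) = a *: T t x.
Proof.
by move=> t0; have := bc_linear hT t0 a (x := x) (y := 0) I I; rewrite semigroup0// !addr0.
Qed.
Lemma semigroupB t x y : 0 <= t -> T t (x - y) = T t x - T t y.
Proof. by move=> t0; rewrite semigroupD// -scaleN1r semigroupZ// scaleN1r. Qed.
Lemma semigroup_add t s x : 0 <= t -> 0 <= s -> T (t + s) x = T t (T s x).
Proof. by move=> t0 s0; exact: (bc_add hT). Qed.
Lemma semigroupC t s x : 0 <= t -> 0 <= s -> T t (T s x) = T s (T t x).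
Proof. by move=> t0 s0; rewrite -!semigroup_add// addrC. Qed.

Lemma semigroup_norm_le t x : 0 <= t -> N (T t x) <= M * N x.
Proof.
move=> t0; apply: le_trans (hexp t0 (I : carrier X x)) _.
rewrite ler_wpM2r ?norm_ge0//.
have [M1' w0'] := (M1, w0).
have M0 : 0 <= M by lra.
have e1 : expR (w * t) <= 1 by rewrite -expR0 ler_expR; nra.
by rewrite ler_piMr.
Qed.

Lemma semigroup_decay e : 0 < e ->
  exists2 t0, 0 < t0 & forall t x, t0 <= t -> N (T t x) <= e * N x.
Proof.
(* For t >= t0 this gives -w t >= M / e, and 1 + u <= exp u then yields M exp(w t) <= e. *)
move=> e0; have [M1' w0'] := (M1, w0); pose t0 := M / (e * - w).
have t00 : 0 < t0 by rewrite divr_gt0// ?mulr_gt0//; lra.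
exists t0 => // t x tt; have tp : 0 <= t by lra.
apply: le_trans (hexp tp (I : carrier X x)) _.
rewrite ler_wpM2r ?norm_ge0//.
have h1 : 1 + - w * t <= expR (- w * t) by exact: expR_ge1Dx.
have h2 : M / e <= - w * t.
  have -> : M / e = - w * t0.
    have [en0 wn0] : e != 0 /\ w != 0 by rewrite gt_eqF// lt_eqF.
    by rewrite /t0; field; rewrite ?oppr_eq0 en0 wn0.
  by rewrite ler_wpM2l//; lra.
have h3 : expR (w * t) = (expR (- w * t))^-1 by rewrite -expRN mulNr opprK.
have Me : 0 < M / e by rewrite divr_gt0//; lra.
rewrite h3 ler_pdivrMr ?expR_gt0//.
have : M / e <= expR (- w * t) by lra.
by rewrite ler_pdivrMr// mulrC.
Qed.

(** Decay forces N x <= N x / 2. This is why the Hoelder seminorms separate points and why A is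
    injective. *)
Lemma semigroup_inj0 x : (forall t, 0 < t -> T t x = x) -> x = 0.
Proof.
move=> h; apply: norm_eq0; have e0 : (0 : R) < 1 / 2 by lra.
have [t t0 /(_ t x (lexx _))] := semigroup_decay e0.
by rewrite h//; have := norm_ge0 x; lra.
Qed.

Lemma semigroup_cvg x (t : R) p (e : R) : 0 <= t -> P p -> 0 < e ->
  \forall s \near within [set s : R | 0 <= s] (nbhs t), p (T s x - T t x) < e.
Proof.
by move=> t0 Pp e0; have /cvg_tauP := bc_continuous hT (I : carrier X x) t0; apply.
Qed.

(* Choosing a bad index in each set of the countable base reduces the claim to the
   sequential equicontinuity in the definition of bi-continuity. *)
Lemma equicontinuous_family (I J : Type) (F : set_system I) (S : set J)
    (f : I -> J -> V) (C : R) {FF : Filter F} : countably_based F ->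
  (\forall i \near F, forall j, S j -> N (f i j) <= C) ->
  (forall p, P p -> forall e, 0 < e ->
     \forall i \near F, forall j, S j -> p (f i j) < e) ->
  forall p t0 e, P p -> 0 <= t0 -> 0 < e ->
    \forall i \near F, forall j s, S j -> 0 <= s <= t0 -> p (T s (f i j)) < e.
Proof.
move=> [B [FB Bb]] fC f0 p t0 e Pp t00 e0; apply: contrapT => nF.
have /choice[u hu] : forall n, exists v, N v <= C /\
    (exists i j, [/\ B n i, S j & v = f i j]) /\
    (exists2 s, 0 <= s <= t0 & e <= p (T s v)).
  move=> n; apply: contrapT => nv; apply: nF.
  apply: filterS (filterI (FB n) fC) => i [Bi Ci] j s Sj st.
  rewrite ltNge; apply/negP => ps; apply: nv; exists (f i j); split; first exact: Ci.
  by split; [exists i, j|exists s].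
have u0 : u @ \oo `=>` tnbhs (tau X) 0.
  apply/cvg_tauP => q Pq d d0.
  have [m hm] := Bb _ (f0 q Pq d d0).
  exists m => // n mn; rewrite subr0; have [_ [[i [j [Bi Sj ->]]] _]] := hu n.
  exact: hm mn _ Bi _ Sj.
have ball_op : tau X [set y | setT y /\ p (y - 0) < e].
  by rewrite /= (hP.1.2 : tau0 = _); apply: seminorm_ball_open => //; exact: hP.1.1.
have := bc_equicontinuous hT t00 (fun=> Logic.I) _ u0 ball_op.
case; first by exists C => n; exact: (hu n).1.
- by split=> //=; rewrite subr0 (seminorm0 VT (dominated_P Pp).1).
- move=> n0 _ /(_ n0 (leqnn n0)) h.
  have [_ [_ [s st]]] := hu n0.
  by have [_] := h s st; rewrite subr0; lra.
Qed.

Lemma equicontinuous (I : Type) (F : set_system I) (f : I -> V) (C : R)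
    {FF : Filter F} : countably_based F ->
  (\forall i \near F, N (f i) <= C) ->
  (forall p, P p -> forall e, 0 < e -> \forall i \near F, p (f i) < e) ->
  forall p t0 e, P p -> 0 <= t0 -> 0 < e ->
    \forall i \near F, forall s, 0 <= s <= t0 -> p (T s (f i)) < e.
Proof.
move=> cF fC f0 p t0 e Pp t00 e0.
have := @equicontinuous_family I unit F setT (fun i _ => f i) C FF cF.
move=> /(_ _ _ p t0 e Pp t00 e0) h.
have {}h := h _ _; apply: filterS (h _ _).
- by move=> i hi s st; exact: (hi tt).
- by apply: filterS fC.
- by move=> q Pq d d0; apply: filterS (f0 q Pq d d0).
Qed.

(** * Hoelder spaces *)

Variable alpha : R.
Local Notation Fs := (F_space X T alpha).
Local Notation Xs := (X_space X T alpha).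
Local Notation H := (holder_seminorm T alpha).
Local Notation Xa := (holder_triple X P T alpha).

Definition holder_quotient (t : R) (x : V) : V := sor (t `^ alpha)^-1 *: (T t x - x).
Local Notation hq := holder_quotient.

Lemma holder_quotientE p t x : dominated p -> 0 < t ->
  p (hq t x) = p (T t x - x) / t `^ alpha.
Proof.
move=> dp t0; rewrite (seminormZr dp.1)// mulrC ger0_norm//.
by rewrite invr_ge0 powR_ge0.
Qed.

Lemma holder_quotientK p t x : dominated p -> 0 < t ->
  p (T t x - x) = t `^ alpha * p (hq t x).
Proof.
by move=> dp t0; rewrite (holder_quotientE x dp t0) mulrC divfK// gt_eqF// powR_gt0.
Qed.

Lemma holder_quotientB t x y : 0 <= t -> hq t (x - y) = hq t x - hq t y.
Proof.
move=> t0; rewrite /hq semigroupB// -scalerBr; congr (_ *: _).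
by rewrite !opprB addrACA [RHS]addrACA [- x + _]addrC.
Qed.
Lemma holder_quotientZ t a x : 0 <= t -> hq t (a *: x) = a *: hq t x.
Proof.
by move=> t0; rewrite /hq semigroupZ// -scalerBr !scalerA mulrC.
Qed.
Lemma holder_quotient0 t : 0 <= t -> hq t 0 = 0.
Proof. by move=> t0; rewrite /hq semigroup0// subrr scaler0. Qed.
Lemma holder_quotientD t x y : 0 <= t -> hq t (x + y) = hq t x + hq t y.
Proof.
move=> t0; have := holder_quotientB x (- y) t0; rewrite opprK => ->.
by rewrite -[- y]sub0r holder_quotientB// holder_quotient0// sub0r opprK.
Qed.
Lemma semigroup_holder_quotient s t x : 0 <= s -> 0 <= t -> T s (hq t x) = hq t (T s x).
Proof. by move=> s0 t0; rewrite /hq semigroupZ// semigroupB// semigroupC. Qed.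

Lemma holder_quotient_norm_le t x : 0 < t -> N (hq t x) <= (M + 1) / t `^ alpha * N x.
Proof.
move=> t0; rewrite (holder_quotientE x dN t0) mulrAC ler_pM2r ?invr_gt0 ?powR_gt0//.
apply: le_trans (seminormB VT dN.1 _ _) _ => //.
by rewrite mulrDl mul1r lerD2r semigroup_norm_le// ltW.
Qed.

Lemma F_spaceP x : Fs x <-> exists C, forall t, 0 < t -> N (hq t x) <= C.
Proof.
split=> [[_ h]|[C h]].
  exists (H N x) => t t0; rewrite (holder_quotientE x dN t0); exact: holder_seminorm_ge.
split=> //; apply: (@holder_sup_lty _ _ _ _ _ _ _ C) => t t0.
by rewrite -(holder_quotientE x dN t0) h.
Qed.

Lemma holder_seminorm_ub p x t : dominated p -> Fs x -> 0 < t -> p (hq t x) <= H p x.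
Proof.
move=> dp /F_spaceP[C h] t0; rewrite (holder_quotientE x dp t0); apply: holder_seminorm_ge => //.
apply: (@holder_sup_lty _ _ _ _ _ _ _ C) => s s0.
by rewrite -(holder_quotientE x dp s0); apply: le_trans (h s s0); exact: dp.2.
Qed.

Lemma holder_seminorm_lub p x C : dominated p ->
  (forall t, 0 < t -> p (hq t x) <= C) -> H p x <= C.
Proof.
move=> dp h; apply: holder_seminorm_le => t t0.
by rewrite -(holder_quotientE x dp t0) h.
Qed.

Lemma holder_seminorm_le_norm p x : dominated p -> Fs x -> H p x <= H N x.
Proof.
move=> dp Fx; apply: holder_seminorm_lub => // t t0.
by apply: le_trans (holder_seminorm_ub dN Fx t0); apply: dp.2.
Qed.

Lemma subspace_F : subspace_of Fs.
Proof.
split.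
  by apply/F_spaceP; exists 0 => t t0; rewrite (holder_quotient0 (ltW t0)) (seminorm0 VT dN.1).
move=> a x y /F_spaceP[C hC] /F_spaceP[C' hC']; apply/F_spaceP.
exists (scalar_abs a * C + C') => t t0.
rewrite (holder_quotientD _ _ (ltW t0)) (holder_quotientZ _ _ (ltW t0)).
apply: le_trans (seminormD dN.1 _ _) _ => //.
by rewrite (seminormZ dN.1)// lerD ?hC'// ler_wpM2l ?hC// scalar_abs_ge0.
Qed.

Lemma holder_seminorm_on p : dominated p -> seminorm_on Fs (H p).
Proof.
move=> dp.
have ge0 x : Fs x -> 0 <= H p x.
  move=> Fx; apply: le_trans (holder_seminorm_ub dp Fx ltr01).
  exact: (seminorm_ge0 dp.1).
split=> [//|x y Fx Fy|a x Fx].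
  apply: holder_seminorm_lub => // t t0; rewrite (holder_quotientD _ _ (ltW t0)).
  by apply: le_trans (seminormD dp.1 _ _) _ => //; rewrite lerD// holder_seminorm_ub.
have Fax : Fs (a *: x) := subspaceZ subspace_F a Fx.
have le : H p (a *: x) <= scalar_abs a * H p x.
  apply: holder_seminorm_lub => // t t0; rewrite (holder_quotientZ _ _ (ltW t0)).
  by rewrite (seminormZ dp.1)// ler_wpM2l ?scalar_abs_ge0// holder_seminorm_ub.
apply/eqP; rewrite eq_le le /=.
have [->|an0] := eqVneq (scalar_abs a) 0; first by rewrite mul0r ge0.
have apos : 0 < scalar_abs a by rewrite lt_def an0 scalar_abs_ge0.
rewrite -ler_pdivlMl//; apply: holder_seminorm_lub => // t t0.
rewrite ler_pdivlMl// -(seminormZ dp.1)// -(holder_quotientZ _ _ (ltW t0)).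
exact: holder_seminorm_ub.
Qed.

Lemma X_spaceP x : Xs x <-> Fs x /\ forall p, P p -> forall e, 0 < e ->
  \forall t \near 0^'+, p (hq t x) < e.
Proof.
split=> -[Fx h]; split => //.
  move=> p Pp e e0; move/cvg_tauP : h => /(_ p Pp e e0).
  by apply: filterS => t; rewrite subr0.
apply/cvg_tauP => p Pp e e0; apply: filterS (h p Pp e e0) => t.
by rewrite subr0.
Qed.

Lemma X_space_F x : Xs x -> Fs x. Proof. by case. Qed.

Lemma subspace_X : subspace_of Xs.
Proof.
split.
  apply/X_spaceP; split; first exact: subspace_F.1.
  move=> p Pp e e0; near=> t; have t0 : 0 < t by near: t; exact: nbhs_right_gt.
  by rewrite (holder_quotient0 (ltW t0)) (seminorm0 VT (dominated_P Pp).1).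
move=> a x y /X_spaceP[Fx hx] /X_spaceP[Fy hy]; apply/X_spaceP; split.
  exact: subspace_F.2.
move=> p Pp e e0; have psn := (dominated_P Pp).1.
pose d := e / 2 / (scalar_abs a + 1).
have a1 : 0 < scalar_abs a + 1 by rewrite ltr_wpDl// scalar_abs_ge0.
have d0 : 0 < d by rewrite !divr_gt0.
have ad : scalar_abs a * d <= e / 2.
  by rewrite /d mulrCA ler_piMr ?divr_ge0 ?(ltW e0)// ler_pdivrMr// mul1r lerDl.
near=> t.
have t0 : 0 < t by near: t; exact: nbhs_right_gt.
have h1 : p (hq t x) < d by near: t; exact: hx.
have h2 : p (hq t y) < e / 2 by near: t; apply: hy => //; exact: divr_gt0.
rewrite (holder_quotientD _ _ (ltW t0)) (holder_quotientZ _ _ (ltW t0)).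
apply: le_lt_trans (seminormD psn _ _) _ => //; rewrite (seminormZ psn)//.
have h3 : scalar_abs a * p (hq t x) <= scalar_abs a * d.
  by rewrite ler_wpM2l ?scalar_abs_ge0// ltW.
lra.
Unshelve. all: by end_near. Qed.

(** Splits x into x - T t x and T t x. The second part is measured by N even when p is a seminorm of
    P, since decay is known for the norm. *)
Lemma seminorm_le_holder p x t : dominated p -> Fs x -> 0 < t ->
  p x <= t `^ alpha * H p x + N (T t x).
Proof.
move=> dp Fx t0.
have h1 : p x <= p (T t x - x) + p (T t x).
  rewrite (seminormBC VT dp.1)//.
  have := seminormD dp.1 (x := x - T t x) (y := T t x) I I; rewrite subrK; exact.
have h2 : p (T t x - x) <= t `^ alpha * H p x.
  by rewrite (holder_quotientK x dp t0) ler_wpM2l ?powR_ge0// holder_seminorm_ub.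
have := dp.2 (T t x); lra.
Qed.

Lemma norm_le_holder : exists2 C, 0 < C & forall x, Fs x -> N x <= C * H N x.
Proof.
have e0 : (0 : R) < 1 / 2 by lra.
(* At this t the term N (T t x) is at most N x / 2 and can be absorbed on the left, which produces
   the constant 2 t^alpha. *)
have [t t0 ht] := semigroup_decay e0.
exists (2 * t `^ alpha); first by rewrite mulr_gt0// powR_gt0.
move=> x Fx; have := seminorm_le_holder dN Fx t0.
have := ht t x (lexx _); lra.
Qed.

(* On norm-bounded sets of the Hoelder space, tau_F is finer than tau: the term
   N (T t x) is made small by letting t be large. *)
Lemma seminorm_lt_holder C e : 0 < e ->
  exists2 d, 0 < d & forall p x, P p -> Fs x -> H N x <= C -> H p x < d -> p x < e.
Proof.
move=> e0; have [C' C'0 hC'] := norm_le_holder.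
pose D := C' * `|C| + 1.
have D0 : 0 < D by rewrite ltr_wpDl// mulr_ge0// ltW.
have [t t0 ht] := @semigroup_decay (e / 2 / D) ltac:(by rewrite !divr_gt0).
have ta0 : 0 < t `^ alpha by exact: powR_gt0.
exists (e / 2 / t `^ alpha); first by rewrite !divr_gt0.
move=> p x Pp Fx HC Hp.
have h1 := seminorm_le_holder (dominated_P Pp) Fx t0.
have h2 := ht t x (lexx _).
have h3 : t `^ alpha * H p x < e / 2 by rewrite mulrC -ltr_pdivlMr.
have h4 : N x <= D.
  apply: le_trans (hC' x Fx) _; rewrite /D.
  have : C' * H N x <= C' * `|C| by rewrite ler_wpM2l ?(ltW C'0)// (le_trans HC)// ler_norm.
  lra.
have h5 : e / 2 / D * N x <= e / 2.
  by rewrite mulrAC ler_pdivrMr// ler_wpM2l// divr_ge0// ltW.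
lra.
Qed.

Lemma holder_P_seminorm q : [set H p | p in P] q -> seminorm_on Xs q.
Proof.
move=> [p Pp <-]; have [h1 h2 h3] := holder_seminorm_on (dominated_P Pp).
split=> [x /X_space_F|x y /X_space_F Fx /X_space_F|a x /X_space_F]; [exact: h1|exact: h2|exact: h3].
Qed.

Lemma cvg_holderP (I : Type) (F : set_system I) (f : I -> V) l : Filter F ->
  Xs l -> (\forall i \near F, Xs (f i)) ->
  (f @ F `=>` tnbhs (tau Xa) l <->
   forall p, P p -> forall e, 0 < e -> \forall i \near F, H p (f i - l) < e).
Proof.
move=> FF Xl Xf; split=> h.
  move=> p Pp.
  have /(_ h) := (@seminorm_cvgP _ _ _ _ _ subspace_X holder_P_seminorm _ _ _ _ FF Xl Xf).1.
  by apply; exists p.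
by apply/(seminorm_cvgP subspace_X holder_P_seminorm FF Xl Xf) => _ [p Pp <-]; exact: h.
Qed.

Lemma holder_ball_open p x e : P p -> Xs x -> 0 < e ->
  tau Xa [set y | Xs y /\ H p (y - x) < e].
Proof.
move=> Pp Xx e0; apply: seminorm_ball_open => //.
- exact: subspace_X.
- exact: holder_P_seminorm.
- by exists p.
Qed.

(** * Assumption (S) for the Hoelder triple *)

Lemma X_space_closed l : Fs l ->
  (forall p, P p -> forall e, 0 < e ->
     exists2 u, Xs u & forall t, 0 < t -> p (hq t (u - l)) <= e) -> Xs l.
Proof.
move=> Fl h; apply/X_spaceP; split => // p Pp e e0; have psn := (dominated_P Pp).1.
(* The approximation of l by u is uniform in t, so the vanishing of the quotients of u at 0 passes
   to l. *)
have [u /X_spaceP[Fu hu] ul] := h p Pp (e / 2) ltac:(lra).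
near=> t.
have t0 : 0 < t by near: t; exact: nbhs_right_gt.
have h1 : p (hq t u) < e / 2 by near: t; apply: hu => //; lra.
have h2 := ul t t0.
have -> : hq t l = hq t u - hq t (u - l) by rewrite -(holder_quotientB _ _ (ltW t0)) subKr.
apply: le_lt_trans (seminormB VT psn _ _) _ => //; lra.
Unshelve. all: by end_near. Qed.

(** Lets m tend to infinity at fixed t: convergence for each t separately and the Cauchy bound,
    uniform in t, give a bound uniform in t. Used with p = N for norm completeness and with p in P
    for sequential completeness. *)
Lemma holder_quotient_lim p (u : nat -> V) l n e : dominated p -> (forall m, Fs (u m)) ->
  (forall t d, 0 < t -> 0 < d -> \forall m \near \oo, p (hq t (u m - l)) < d) ->
  (\forall m \near \oo, H p (u n - u m) <= e) ->
  forall t, 0 < t -> p (hq t (u n - l)) <= e.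
Proof.
move=> dp Fu ul un t t0; apply/ler_addgt0Pr => d d0.
have [m [h1 h2]] := filter_ex (filterI (ul t d t0 d0) un).
have -> : hq t (u n - l) = hq t (u n - u m) + hq t (u m - l).
  by rewrite -(holder_quotientD _ _ (ltW t0)) addrA subrK.
apply: le_trans (seminormD dp.1 _ _) _ => //.
have := holder_seminorm_ub dp (subspaceB subspace_F (Fu n) (Fu m)) t0; lra.
Qed.

Lemma holder_norm_complete : norm_complete Xa.
Proof.
move=> u Xu uC; have Fu n := X_space_F (Xu n).
have [C C0 hC] := norm_le_holder.
have [] := S_banach hS (u := u) (fun=> I).
  move=> e e0; have [n0 hn] := uC (e / C) ltac:(by rewrite divr_gt0).
  exists n0 => m n nm nn; have := hn m n nm nn; rewrite /= ltr_pdivlMr// mulrC.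
  by apply: le_lt_trans; apply: hC; exact: (subspaceB subspace_F).
move=> l _ ul.
have lim e : 0 < e -> \forall n \near \oo, forall t, 0 < t -> N (hq t (u n - l)) <= e.
  move=> e0; have [n0 hn] := uC e e0; exists n0 => // n /= n0n.
  apply: (@holder_quotient_lim N u l n e dN Fu).
    move=> t d t0 d0.
    have Ct0 : 0 < (M + 1) / t `^ alpha.
      by have M1' := M1; rewrite divr_gt0 ?powR_gt0//; lra.
    have dC : 0 < d / ((M + 1) / t `^ alpha) by rewrite divr_gt0.
    move/cvgr0Pnorm_lt : ul => /(_ _ dC); apply: filterS => m; rewrite /= ger0_norm ?norm_ge0//.
    rewrite ltr_pdivlMr// mulrC; apply: le_lt_trans; exact: holder_quotient_norm_le.
  by exists n0 => // m /= nm; apply/ltW/hn.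
have Fl : Fs l.
  have [n hn] := filter_ex (lim 1 ltr01).
  apply/F_spaceP; exists (H N (u n) + 1) => t t0.
  have -> : hq t l = hq t (u n) - hq t (u n - l) by rewrite -(holder_quotientB _ _ (ltW t0)) subKr.
  apply: le_trans (seminormB VT dN.1 _ _) _ => //.
  by apply: lerD; [exact: (holder_seminorm_ub dN (Fu n) t0)|exact: hn].
exists l.
  apply: X_space_closed => // p Pp e e0; have [n hn] := filter_ex (lim e e0).
  exists (u n); first exact: Xu.
  by move=> t t0; apply: le_trans (hn t t0); exact: (dominated_P Pp).2.
apply/cvgr0Pnorm_le => e e0; apply: filterS (lim e e0) => n hn.
rewrite ger0_norm; first exact: (holder_seminorm_lub dN hn).
by apply: (seminorm_ge0 (holder_seminorm_on dN)); apply: (subspaceB subspace_F).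
Qed.

(** Sequential completeness is assumed on the unit ball, so the sequence is scaled by 1 / c; the
    maximum with 1 keeps c positive whatever C is. *)
Lemma tau_complete_bounded (u : nat -> V) C : (forall n, N (u n) <= C) ->
  (forall p, P p -> forall e, 0 < e -> exists n0 : nat, forall m n : nat,
     (n0 <= m)%N -> (n0 <= n)%N -> p (u m - u n) < e) ->
  exists l, forall p, P p -> forall e, 0 < e -> \forall m \near \oo, p (u m - l) < e.
Proof.
move=> uC uCauchy; pose c := Num.max C 1.
have c0 : 0 < c by rewrite lt_max ltr01 orbT.
have cn : `|c^-1| = c^-1 by rewrite ger0_norm// invr_ge0 ltW.
pose v n := sor c^-1 *: u n.
have vball n : unit_ball X (v n).
  split=> //=; rewrite /v (seminormZr dN.1)// cn mulrC ler_pdivrMr// mul1r.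
  by rewrite le_max uC.
have vCauchy : tau_cauchy X v.
  move=> U tU U0; have [n [p [e [Pp e0 pU]]]] := tau_open_seminorms tU U0.
  have /choice[b hb] : forall i, exists n0 : nat, forall m m' : nat,
      (n0 <= m)%N -> (n0 <= m')%N -> p i (u m - u m') < e * c.
    by move=> i; apply: uCauchy => //; rewrite mulr_gt0.
  exists (\max_(i < n) b i)%N => m m' nm nm'; apply: pU => // i.
  rewrite subr0 -scalerBr (seminormZr (dominated_P (Pp i)).1)// cn mulrC ltr_pdivrMr//.
  by apply: hb; [apply: leq_trans nm|apply: leq_trans nm']; exact: leq_bigmax.
have [l _ vl] := S_seq_complete hS vball vCauchy.
exists (sor c *: l) => p Pp e e0.
move/cvg_tauP : vl => /(_ p Pp (e / c)); rewrite divr_gt0// => /(_ isT).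
apply: filterS => m; rewrite ltr_pdivlMr//.
have -> : u m = sor c *: v m by rewrite /v scalerA -rmorphM divff ?gt_eqF// rmorph1 scale1r.
by rewrite -scalerBr (seminormZr (dominated_P Pp).1)// ger0_norm ?ltW// mulrC.
Qed.

(** The unit ball for [H N] is norm-bounded, so a Cauchy sequence for tau_F in it is Cauchy for tau
    and has a tau-limit l. At fixed t, [T t (u m - l)] is tau-null because the sequence is bounded.
    The limit stays in the ball since N is the supremum of P. *)
Lemma holder_seq_complete : seq_complete_on_ball Xa.
Proof.
move=> u uball uCauchy.
have Xu n : Xs (u n) by case: (uball n).
have Fu n : Fs (u n) := X_space_F (Xu n).
have u1 n : H N (u n) <= 1 by case: (uball n).
have HCauchy p : P p -> forall e, 0 < e -> exists n0 : nat, forall m n : nat,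
    (n0 <= m)%N -> (n0 <= n)%N -> H p (u m - u n) < e.
  move=> Pp e e0; have [] := uCauchy _ (holder_ball_open Pp subspace_X.1 e0).
    split; first exact: subspace_X.1.
    by rewrite subr0 (seminorm0 subspace_F (holder_seminorm_on (dominated_P Pp))).
  by move=> n0 h; exists n0 => m n nm nn; have [_] := h m n nm nn; rewrite subr0.
have [C C0 hC] := norm_le_holder.
have [|p Pp e e0|l ul] := @tau_complete_bounded u C.
- by move=> n; apply: le_trans (hC _ (Fu n)) _; rewrite ler_piMr// ltW.
(* Differences of two points of the unit ball have Hoelder norm at most 2. *)
- have [d d0 hd] := @seminorm_lt_holder 2 e e0.
  have [n0 hn] := HCauchy p Pp d d0; exists n0 => m n nm nn.
  apply: hd => //; [exact: (subspaceB subspace_F)| |exact: hn].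
  apply: le_trans (seminormB subspace_F (holder_seminorm_on dN) (Fu m) (Fu n)) _.
  by have := u1 m; have := u1 n; lra.
have ql p : P p -> forall t d, 0 < t -> 0 < d -> \forall m \near \oo, p (hq t (u m - l)) < d.
  move=> Pp t d t0 d0; pose d' := d / 2 * t `^ alpha.
  have d'0 : 0 < d' by rewrite mulr_gt0 ?divr_gt0// powR_gt0.
  have ub : \forall m \near \oo, N (u m - l) <= C + N l.
    apply: nearW => m; apply: le_trans (seminormB VT dN.1 _ _) _ => //.
    by rewrite lerD2r; apply: le_trans (hC _ (Fu m)) _; rewrite ler_piMr// ltW.
  have h := equicontinuous countably_based_eventually ub ul Pp (ltW t0) d'0.
  apply: filterS (filterI (h _) (ul p Pp d' d'0)) => m [h1 h2].
  rewrite (holder_quotientE _ (dominated_P Pp) t0) ltr_pdivrMr ?powR_gt0//.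
  apply: le_lt_trans (seminormB VT (dominated_P Pp).1 _ _) _ => //.
  have := h1 t; rewrite lexx (ltW t0) => /(_ isT); rewrite /d' in h2 *; lra.
have lim p : P p -> forall e, 0 < e ->
    \forall n \near \oo, forall t, 0 < t -> p (hq t (u n - l)) <= e.
  move=> Pp e e0; have [n0 hn] := HCauchy p Pp e e0; exists n0 => // n /= n0n.
  apply: (holder_quotient_lim (dominated_P Pp) Fu (ql p Pp)).
  by exists n0 => // m /= nm; apply/ltW/hn.
have l1 t : 0 < t -> N (hq t l) <= 1.
  move=> t0; apply: norm_le_P => p Pp; apply/ler_addgt0Pr => e e0.
  have [n hn] := filter_ex (lim p Pp e e0).
  have -> : hq t l = hq t (u n) - hq t (u n - l).
    by rewrite -(holder_quotientB _ _ (ltW t0)) subKr.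
  apply: le_trans (seminormB VT (dominated_P Pp).1 _ _) _ => //.
  apply: lerD; last exact: hn.
  apply: le_trans ((dominated_P Pp).2 _) _.
  by apply: le_trans (holder_seminorm_ub dN (Fu n) t0) _.
have Xl : Xs l.
  apply: X_space_closed; first by apply/F_spaceP; exists 1.
  move=> p Pp e e0; have [n hn] := filter_ex (lim p Pp e e0).
  by exists (u n) => //; exact: Xu.
exists l.
  by split=> //=; exact: (holder_seminorm_lub dN l1).
apply/cvg_holderP => //; first exact: nearW.
move=> p Pp e e0; have := lim p Pp (e / 2) ltac:(lra).
apply: filterS => n hn; apply: (@le_lt_trans _ _ (e / 2)); last lra.
exact: (holder_seminorm_lub (dominated_P Pp) hn).
Qed.

(* T t is not tau-continuous, but T t - 1 is continuous from tau_F to tau. *)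
Lemma dual_holder_quotient phi t : 0 < t -> dual_unit_ball X phi ->
  dual_unit_ball Xa (phi \o hq t).
Proof.
move=> t0 [phiL phiC phiN]; split => /=.
- move=> a x y _ _; rewrite (holder_quotientD _ _ (ltW t0)) (holder_quotientZ _ _ (ltW t0)).
  exact: phiL.
- move=> x Xx A /(phiC (hq t x) I)[U tU [Ux UA]].
  exists [set y | Xs y /\ U (hq t y)]; last by split => // y [_] /UA.
  split=> [y []//|y [Xy Uy]].
  have [n [p [e [Pp e0 pU]]]] := tau_open_seminorms tU Uy.
  exists n, (fun i => H (p i)), e; split => //; first by move=> i; exists (p i).
  move=> z Xz hz; split => //; apply: pU => // i.
  rewrite -(holder_quotientB _ _ (ltW t0)); apply: le_lt_trans (hz i).
  apply: (holder_seminorm_ub (dominated_P (Pp i)) _ t0).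
  exact: X_space_F (subspaceB subspace_X Xz Xy).
- move=> x Xx; apply: le_trans (phiN _ I) _.
  exact: (holder_seminorm_ub dN (X_space_F Xx) t0).
Qed.

Lemma holder_norming x : Xs x ->
  (H N x)%:E = ereal_sup [set (scalar_abs (phi x))%:E | phi in dual_unit_ball Xa].
Proof.
move=> Xx; set S := ereal_sup _.
have le t : 0 < t -> ((N (hq t x))%:E <= S)%E.
  move=> t0; rewrite (S_norming hS (I : carrier X (hq t x))).
  apply: ge_ereal_sup => _ [phi dphi <-]; apply: ereal_sup_ubound.
  by exists (phi \o hq t) => //; exact: dual_holder_quotient.
apply/eqP; rewrite eq_le; apply/andP; split; last first.
  by apply: ge_ereal_sup => _ [phi [_ _ phiN] <-]; rewrite lee_fin; exact: phiN.
case: S le => [r| |] le; last by have := le 1 ltr01.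
- rewrite lee_fin; apply: (holder_seminorm_lub dN) => t t0.
  by rewrite -lee_fin; exact: le.
- exact: leey.
Qed.

Lemma holder_eq0 x : Xs x -> (forall p, P p -> H p x = 0) -> x = 0.
Proof.
move=> Xx Hx; apply: semigroup_inj0 => t t0; apply/eqP; rewrite -subr_eq0; apply/eqP.
apply: P_separates => p Pp; apply/eqP; have dp := dominated_P Pp.
rewrite eq_le (seminorm_ge0 dp.1)// andbT (holder_quotientK x dp t0).
rewrite -(mulr0 (t `^ alpha)) ler_pM2l ?powR_gt0// -(Hx p Pp).
exact: (holder_seminorm_ub dp (X_space_F Xx) t0).
Qed.

Lemma holder_assumption_S : assumption_S Xa.
Proof.
split.
- exact: subspace_X.
- split=> [|x Xx H0].
    have [h1 h2 h3] := holder_seminorm_on dN.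
    by split=> [x /X_space_F|x y /X_space_F Fx /X_space_F|a x /X_space_F];
      [exact: h1|exact: h2|exact: h3].
  apply: holder_eq0 => // p Pp; apply/eqP; have Fx := X_space_F Xx.
  rewrite eq_le (seminorm_ge0 (holder_seminorm_on (dominated_P Pp)))// andbT -H0.
  exact: (holder_seminorm_le_norm (dominated_P Pp)).
- exact: holder_norm_complete.
- exists [set H p | p in P]; split => // q; exact: holder_P_seminorm.
- apply: seminorm_hausdorff; [exact: subspace_X|exact: holder_P_seminorm|].
  by move=> x Xx Hx; apply: holder_eq0 => // p Pp; apply: Hx; exists p.
- move=> U [UX Uo]; split => // x Ux; have [n [q [e [Pq e0 qU]]]] := Uo x Ux.
  exists 1%N, (fun=> H N), e; split => // y Xy hy; apply: qU => // i.
  have [p Pp <-] := Pq i; apply: le_lt_trans (hy ord0).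
  apply: (holder_seminorm_le_norm (dominated_P Pp)).
  exact: X_space_F (subspaceB subspace_X Xy (UX _ Ux)).
- exact: holder_seq_complete.
- exact: holder_norming.
Qed.

(** * The restricted semigroup *)

Lemma X_space_equicontinuous x p t0 e : Xs x -> P p -> 0 <= t0 -> 0 < e ->
  \forall h \near 0^'+, forall s, 0 <= s <= t0 -> p (T s (hq h x)) < e.
Proof.
move=> /X_spaceP[Fx hx] Pp t00 e0.
(* The quotients are norm-bounded by [H N x] and tau-null as h tends to 0, so equicontinuity
   applies. As T s commutes with [hq h], this controls the quotients of all T s x with s in [0, t0]
   at once. *)
apply: (@equicontinuous _ _ (hq^~ x) (H N x) _ (countably_based_right0 R)) => //.
near=> t; apply: (holder_seminorm_ub dN Fx).
by near: t; exact: nbhs_right_gt.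
Unshelve. all: by end_near. Qed.

Lemma semigroup_holder_le t x : 0 <= t -> Fs x ->
  Fs (T t x) /\ H N (T t x) <= M * expR (w * t) * H N x.
Proof.
move=> t0 Fx.
have h s : 0 < s -> N (hq s (T t x)) <= M * expR (w * t) * H N x.
  move=> s0; rewrite -(semigroup_holder_quotient _ t0 (ltW s0)).
  apply: le_trans (hexp t0 (I : carrier X (hq s x))) _.
  have M0 : 0 <= M by apply: le_trans M1.
  rewrite ler_wpM2l// ?mulr_ge0 ?expR_ge0//.
  exact: (holder_seminorm_ub dN Fx s0).
split; last exact: (holder_seminorm_lub dN h).
by apply/F_spaceP; exists (M * expR (w * t) * H N x).
Qed.

Lemma semigroup_X_space t x : 0 <= t -> Xs x -> Xs (T t x).
Proof.
move=> t0 Xx; apply/X_spaceP; split; first exact: (semigroup_holder_le t0 (X_space_F Xx)).1.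
move=> p Pp e e0; near=> h.
have h0 : 0 < h by near: h; exact: nbhs_right_gt.
rewrite -(semigroup_holder_quotient _ t0 (ltW h0)).
have : forall s, 0 <= s <= t -> p (T s (hq h x)) < e.
  by near: h; exact: X_space_equicontinuous.
by apply; rewrite t0 lexx.
Unshelve. all: by end_near. Qed.

Hypothesis alpha0 : 0 < alpha.

(** The supremum over h is cut at d. Below d, the quotients of T s x and T t x are both small
    because x lies in X_alpha. Above d, the denominator is at least d^alpha and T h (T s x - T t x)
    is small uniformly in h: by equicontinuity for h up to t1, by decay beyond. *)
Lemma holder_orbit_cvg x (t : R) p (e : R) : Xs x -> 0 <= t -> P p -> 0 < e ->
  \forall s \near within [set s : R | 0 <= s] (nbhs t), H p (T s x - T t x) < e.
Proof.
move=> Xx t0 Pp e0; have psn := (dominated_P Pp).1.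
have t10 : 0 <= t + 1 by lra.
have e40 : 0 < e / 4 by lra.
have [e20 e2] : 0 <= e / 2 /\ e / 2 < e by split; lra.
have e44 (a b : R) : a < e / 4 -> b < e / 4 -> a + b <= e / 2 by lra.
have e4M (a : R) : e / 4 * a + e / 4 * a = e / 2 * a by lra.
have [d /= d0 hd] : exists2 d, 0 < d & forall h, 0 < h < d ->
    forall s, 0 <= s <= t + 1 -> p (T s (hq h x)) < e / 4.
  have := X_space_equicontinuous Xx Pp t10 e40.
  rewrite /at_right /within /= => /nbhs_ballP[d /= d0 hd]; exists d => // h /andP[h0 hd'].
  by apply: hd => //; rewrite /ball /= sub0r normrN gtr0_norm.
(* For h >= d the numerator is bounded by two terms of size eta, which gives e / 2 after division by
   h^alpha. *)
pose eta := e / 4 * d `^ alpha.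
have da0 : 0 < d `^ alpha by exact: powR_gt0.
have eta0 : 0 < eta by rewrite mulr_gt0.
pose C := 2 * (M * N x).
have M0 : 0 <= M by apply: le_trans M1.
have C0 : 0 <= C by rewrite !mulr_ge0// norm_ge0.
(* C bounds the norm of T s x - T t x, so after time t1 every such difference has been shrunk below
   eta. *)
have [t1 t10' ht1] := @semigroup_decay (eta / (C + 1)) ltac:(by rewrite divr_gt0// ltr_wpDl).
have yC s : 0 <= s -> N (T s x - T t x) <= C.
  move=> s0; apply: le_trans (seminormB VT dN.1 _ _) _ => //.
  by have := semigroup_norm_le x s0; have := semigroup_norm_le x t0; rewrite /C; lra.
have small : \forall s \near within [set s : R | 0 <= s] (nbhs t),
    forall h, 0 <= h <= t1 -> p (T h (T s x - T t x)) < eta.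
  apply: (@equicontinuous _ _ (fun s => T s x - T t x) C _ (countably_based_within _ _))
      => //; last exact: ltW.
    by near=> s; apply: yC; near: s; exact: withinT.
  by move=> q Pq d' d'0; exact: semigroup_cvg.
near=> s.
have s0 : 0 <= s by near: s; exact: withinT.
have st : s <= t + 1.
  near: s; rewrite near_withinE; near=> r => _; apply/ltW; near: r.
  by apply: lt_nbhsl; lra.
have hs : forall h, 0 <= h <= t1 -> p (T h (T s x - T t x)) < eta by near: s.
have hs' h : 0 <= h -> p (T h (T s x - T t x)) <= eta.
  move=> h0; have [ht|ht] := leP h t1; first by apply/ltW/hs; rewrite h0.
  apply: le_trans ((dominated_P Pp).2 _) _.
  apply: le_trans (ht1 _ _ (ltW ht)) _.
  rewrite mulrAC ler_pdivrMr ?ltr_wpDl// ler_wpM2l ?(ltW eta0)//.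
  by apply: le_trans (yC s s0) _; rewrite lerDl.
apply: (@le_lt_trans _ _ (e / 2)) => //.
apply: (holder_seminorm_lub (dominated_P Pp)) => h h0.
have [hd'|dh] := ltP h d.
  rewrite (holder_quotientB _ _ (ltW h0)) -!(semigroup_holder_quotient _ _ (ltW h0))//.
  apply: le_trans (seminormB VT psn _ _) _ => //.
  have := hd h; rewrite h0 hd' => /(_ isT) hh.
  by apply: e44; apply: hh; rewrite ?s0 ?t0 ?st ?lerDl ?ler01.
rewrite (holder_quotientE _ (dominated_P Pp) h0) ler_pdivrMr ?powR_gt0//.
apply: le_trans (seminormB VT psn _ _) _ => //.
have := hs' h (ltW h0); have := hs' 0 (lexx _); rewrite (bc_zero hT I) => h1 h2.
have h3 : d `^ alpha <= h `^ alpha by rewrite ge0_ler_powR// ?nnegrE ltW.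
apply: (@le_trans _ _ (eta + eta)); first by rewrite lerD.
by rewrite /eta e4M ler_wpM2l.
Unshelve. all: by end_near. Qed.

(** Here the second index of [equicontinuous_family] is the step h: the vectors [hq h (u n)] are
    bounded and tau-null in n uniformly in h > 0. *)
Lemma holder_equicontinuous (u : nat -> V) C p t0 e : (forall n, Fs (u n)) ->
  (forall n, H N (u n) <= C) ->
  (forall q, P q -> forall d, 0 < d -> \forall n \near \oo, H q (u n) < d) ->
  P p -> 0 <= t0 -> 0 < e ->
  \forall n \near \oo, forall s, 0 <= s <= t0 -> H p (T s (u n)) < e.
Proof.
move=> Fu uC u0 Pp t00 e0; have e20 : 0 < e / 2 by lra.
have FF : Filter \oo by typeclasses eauto.
have := @equicontinuous_family _ _ \oo [set h : R | 0 < h] (fun n h => hq h (u n)) C FF.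
move=> /(_ countably_based_eventually _ _ p t0 (e / 2) Pp t00 e20) h.
apply: filterS (h _ _) => {h}.
- move=> n hn s /andP[s0 st]; apply: (@le_lt_trans _ _ (e / 2)); last lra.
  apply: (holder_seminorm_lub (dominated_P Pp)) => h h0.
  rewrite -(semigroup_holder_quotient _ s0 (ltW h0)); apply/ltW/hn => //.
  by rewrite s0.
- apply: nearW => n h h0.
  by apply: le_trans (uC n); exact: (holder_seminorm_ub dN (Fu n) h0).
- move=> q Pq d d0; apply: filterS (u0 q Pq d d0) => n hn h h0.
  by apply: le_lt_trans hn; exact: (holder_seminorm_ub (dominated_P Pq) (Fu n) h0).
Qed.

Lemma holder_bicontinuous : bicontinuous_semigroup Xa T.
Proof.
split.
- by move=> t x t0; exact: semigroup_X_space.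
- by move=> t t0 a x y _ _; exact: (bc_linear hT).
- by move=> x _; exact: (bc_zero hT).
- by move=> t s x t0 s0 _; exact: semigroup_add.
- move=> x t Xx t0; apply/cvg_holderP.
  + exact: semigroup_X_space.
  + near=> s; apply: semigroup_X_space => //; near: s; exact: withinT.
  + by move=> p Pp e e0; exact: holder_orbit_cvg.
- by exists M, w; split => // t x t0 Xx; exact: (semigroup_holder_le t0 (X_space_F Xx)).2.
- move=> u t0 t00 Xu [C uC] u0 U [_ Uo] U0.
  have Fu n : Fs (u n) := X_space_F (Xu n).
  have [n [q [e [Pq e0 qU]]]] := Uo 0 U0.
  have hq0 : \forall n \near \oo, Xs (u n) by exact: nearW.
  have hu p : P p -> forall d, 0 < d -> \forall n \near \oo, H p (u n) < d.
    move=> Pp d d0; move/(cvg_holderP _ subspace_X.1 hq0) : u0 => /(_ p Pp d d0).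
    by apply: filterS => m; rewrite subr0.
  have : \forall m \near \oo, forall i s, 0 <= s <= t0 -> q i (T s (u m)) < e.
    by apply: filter_forall => i; have [p Pp <-] := Pq i; exact: (holder_equicontinuous Fu uC).
  apply: filterS => m hm s st; apply: qU => [|i]; last by rewrite subr0; exact: hm.
  by apply: semigroup_X_space; [case/andP: st|exact: Xu].
Unshelve. all: by end_near. Qed.

(** * The generator *)

Lemma ereal_sup_quotient_lty (q : R -> R) :
  (ereal_sup [set (q t / t)%:E | t in [set t : R | (0 < t <= 1)%R]] < +oo)%E <->
  exists C, forall t, 0 < t <= 1 -> q t <= C * t.
Proof.
set S := ereal_sup _; have le t : 0 < t <= 1 -> ((q t / t)%:E <= S)%E.
  by move=> t01; apply: ereal_sup_ubound; exists t.
split=> [Soo|[C hC]].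
  case: S le Soo => // [r|] le _; last by have := le 1; rewrite ltr01 lexx => /(_ isT).
  exists r => t t01; have := le t t01; rewrite lee_fin ler_pdivrMr//.
  by case/andP: t01.
apply: le_lt_trans (ltry C); apply: ge_ereal_sup => _ [t t01 <-].
by rewrite lee_fin ler_pdivrMr ?hC//; case/andP: t01.
Qed.

Lemma is_gen_valueP x y : is_gen_value X T x y <->
  forall p, P p -> forall e, 0 < e ->
    \forall t \near 0^'+, p (sor t^-1 *: (T t x - x) - y) < e.
Proof.
split=> [[_ h]|h]; first by move/cvg_tauP : h.
by split => //; apply/cvg_tauP.
Qed.

Lemma is_gen_value_unique x y z : is_gen_value X T x y -> is_gen_value X T x z -> y = z.
Proof.
move=> /is_gen_valueP hy /is_gen_valueP hz; apply/eqP; rewrite -subr_eq0; apply/eqP.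
apply: P_separates => p Pp; apply/eqP; have psn := (dominated_P Pp).1.
rewrite eq_le (seminorm_ge0 psn)// andbT; apply/ler_addgt0Pr => e e0; rewrite add0r.
have e20 : 0 < e / 2 by lra.
have [t [h1 h2]] := filter_ex (filterI (hy p Pp _ e20) (hz p Pp _ e20)).
have := seminorm_tri VT psn (x := y) (y := z) (z := sor t^-1 *: (T t x - x)) I I I.
rewrite (seminormBC VT psn (x := y) (y := sor t^-1 *: (T t x - x)))//; lra.
Qed.

Lemma gen_eq x y : is_gen_value X T x y -> gen X T x = y.
Proof.
move=> hy; apply: (is_gen_value_unique _ hy).
by apply: (@xgetPex _ 0 (is_gen_value X T x)); exists y.
Qed.

Lemma gen_domP x : gen_dom X T x <-> (exists y, is_gen_value X T x y) /\
  exists C, forall t, 0 < t <= 1 -> N (T t x - x) <= C * t.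
Proof.
split=> [[_ ? /(ereal_sup_quotient_lty (fun t => N (T t x - x)))]|[? ?]]; first by split.
by split => //; exact/(ereal_sup_quotient_lty (fun t => N (T t x - x))).
Qed.

Lemma gen_dom_value x : gen_dom X T x -> is_gen_value X T x (gen X T x).
Proof. by move=> [_ [y hy] _]; rewrite (gen_eq hy). Qed.

Lemma is_gen_value_linear a x y u v : is_gen_value X T x u -> is_gen_value X T y v ->
  is_gen_value X T (a *: x + y) (a *: u + v).
Proof.
move=> /is_gen_valueP hx /is_gen_valueP hy; apply/is_gen_valueP => p Pp e e0.
have psn := (dominated_P Pp).1; have a0 := scalar_abs_ge0 a.
have a1 : 0 < scalar_abs a + 1 by rewrite ltr_wpDl.
have d0 : 0 < e / 2 / (scalar_abs a + 1) by rewrite !divr_gt0.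
have e20 : 0 < e / 2 by lra.
have ad : scalar_abs a * (e / 2 / (scalar_abs a + 1)) <= e / 2.
  by rewrite mulrCA ler_piMr ?(ltW e20)// ler_pdivrMr// mul1r lerDl.
near=> t.
have t0 : 0 <= t by apply: ltW; near: t; exact: nbhs_right_gt.
have h1 : p (sor t^-1 *: (T t x - x) - u) < e / 2 / (scalar_abs a + 1).
  by near: t; exact: hx.
have h2 : p (sor t^-1 *: (T t y - y) - v) < e / 2 by near: t; exact: hy.
have -> : sor t^-1 *: (T t (a *: x + y) - (a *: x + y)) - (a *: u + v) =
    a *: (sor t^-1 *: (T t x - x) - u) + (sor t^-1 *: (T t y - y) - v).
  rewrite semigroupD// semigroupZ// opprD addrACA -scalerBr scalerDr.
  by rewrite scalerA mulrC -scalerA opprD addrACA -scalerBr.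
apply: le_lt_trans (seminormD psn _ _) _ => //; rewrite (seminormZ psn)//.
have h3 : scalar_abs a * p (sor t^-1 *: (T t x - x) - u) <= e / 2.
  by apply: le_trans ad; rewrite ler_wpM2l// ltW.
lra.
Unshelve. all: by end_near. Qed.

Lemma gen_dom_linear a x y : gen_dom X T x -> gen_dom X T y ->
  gen_dom X T (a *: x + y) /\ gen X T (a *: x + y) = a *: gen X T x + gen X T y.
Proof.
move=> Dx Dy; have h := is_gen_value_linear a (gen_dom_value Dx) (gen_dom_value Dy).
split; last exact: gen_eq.
have [[_ [C hC]] [_ [C' hC']]] := ((gen_domP x).1 Dx, (gen_domP y).1 Dy).
apply/gen_domP; split; first by exists (a *: gen X T x + gen X T y).
exists (scalar_abs a * C + C') => t t01; have t0 : 0 <= t by case/andP: t01 => /ltW.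
rewrite semigroupD// semigroupZ// opprD addrACA -scalerBr.
apply: le_trans (seminormD dN.1 _ _) _ => //; rewrite (seminormZ dN.1)// mulrDl -mulrA.
by apply: lerD; [rewrite ler_wpM2l ?scalar_abs_ge0// hC|exact: hC'].
Qed.

Lemma gen_dom_lipschitz x : gen_dom X T x ->
  exists2 C, 0 <= C & forall s r, 0 <= s -> s <= r -> N (T r x - T s x) <= C * (r - s).
Proof.
move=> /gen_domP[_ [C hC]].
have M0 : 0 <= M by apply: le_trans M1.
(* C serves increments of length at most 1; for longer ones M N x + N x bounds the difference
   outright. The factor M comes from shifting by T s. *)
exists (M * (`|C| + M * N x + N x)).
  by rewrite mulr_ge0// !addr_ge0// ?mulr_ge0// norm_ge0.
move=> s r s0 sr.
have rs0 : 0 <= r - s by rewrite subr_ge0.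
have -> : T r x - T s x = T s (T (r - s) x - x).
  by rewrite semigroupB// -semigroup_add// [s + _]addrC subrK.
apply: le_trans (semigroup_norm_le _ s0) _; rewrite -mulrA ler_wpM2l//.
have [->|rsn0] := eqVneq (r - s) 0.
  by rewrite mulr0 (bc_zero hT)// subrr (seminorm0 VT dN.1).
have rspos : 0 < r - s by rewrite lt_def rsn0.
have Nx := norm_ge0 x; have MN : 0 <= M * N x by rewrite mulr_ge0.
have [rs1|rs1] := leP (r - s) 1.
  apply: le_trans (hC _ _) _; first by rewrite rspos.
  by rewrite ler_wpM2r// -addrA (le_trans (ler_norm C))// lerDl addr_ge0.
apply: le_trans (seminormB VT dN.1 _ _) _ => //.
apply: (@le_trans _ _ (M * N x + N x)); first by rewrite lerD2r semigroup_norm_le.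
apply: (@le_trans _ _ (`|C| + M * N x + N x)); first by rewrite -addrA lerDr.
by rewrite ler_peMr ?(ltW rs1)// !addr_ge0.
Qed.

(** T s cannot simply be applied to the tau-limit that defines y. The domain bounds the difference
    quotients in norm, and equicontinuity then carries the limit through T s. *)
Lemma gen_derivative x y p s e : gen_dom X T x -> is_gen_value X T x y -> P p ->
  0 <= s -> 0 < e ->
  \forall r \near 0^'+, p (T (s + r) x - T s x - sor r *: T s y) <= e * r.
Proof.
move=> Dx /is_gen_valueP hy Pp s0 e0; have [C C0 hC] := gen_dom_lipschitz Dx.
have FF : Filter (0 : R)^'+ by typeclasses eauto.
have := @equicontinuous _ (0 : R)^'+ (fun r => sor r^-1 *: (T r x - x) - y) (C + N y) FF
  (countably_based_right0 R).
move=> /(_ _ hy p s e Pp s0 e0) h.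
near=> r.
have r0 : 0 < r by near: r; exact: nbhs_right_gt.
have -> : T (s + r) x - T s x - sor r *: T s y =
    sor r *: T s (sor r^-1 *: (T r x - x) - y).
  rewrite semigroupB// semigroupZ// semigroupB// -semigroup_add ?(ltW r0)//.
  by rewrite [RHS]scalerBr scalerA -rmorphM divff ?gt_eqF// rmorph1 scale1r.
rewrite (seminormZr (dominated_P Pp).1)// gtr0_norm// mulrC ler_pM2r//; apply: ltW.
suff : forall s', 0 <= s' <= s -> p (T s' (sor r^-1 *: (T r x - x) - y)) < e.
  by apply; rewrite s0 lexx.
near: r; apply: h; near=> r.
have r0 : 0 < r by near: r; exact: nbhs_right_gt.
apply: le_trans (seminormB VT dN.1 _ _) _ => //; rewrite lerD2r.
rewrite (seminormZr dN.1)// gtr0_norm ?invr_gt0// ler_pdivrMl// mulrC.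
by have := hC 0 r (lexx _) (ltW r0); rewrite subr0 (bc_zero hT).
Unshelve. all: by end_near. Qed.

(** The curve s -> (T h - 1)(T s x - s z) has right derivative (T h - 1)(T s y - z). With z = 0 this
    bounds the increments of the orbit in the Hoelder norm; with z = y it bounds the first-order
    remainder. *)
Lemma gen_mean_value x y z p h t K : gen_dom X T x -> is_gen_value X T x y -> P p ->
  0 <= h -> 0 <= t ->
  (forall s, 0 <= s <= t -> p (T h (T s y - z) - (T s y - z)) <= K) ->
  p (T h (T t x - x - sor t *: z) - (T t x - x - sor t *: z)) <= K * t.
Proof.
move=> Dx hy Pp h0 t0 hK; have psn := (dominated_P Pp).1.
have [C C0 hC] := gen_dom_lipschitz Dx.
have M0 : 0 <= M by apply: le_trans M1.
pose v s := T s x - sor s *: z.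
pose g s := T h (v s) - v s.
have gB s s' : g s - g s' = T h (v s - v s') - (v s - v s').
  by rewrite semigroupB// opprD addrACA -opprD.
have -> : T t x - x - sor t *: z = v t - v 0.
  by rewrite /v (bc_zero hT)// rmorph0 scale0r subr0 addrAC.
rewrite -gB; apply: (@seminorm_mean_value_lipschitz _ _ _ p g ((M + 1) * (C + N z)) K t) => //.
  move=> s s' s'0 s's; have ss'0 : 0 <= s - s' by rewrite subr_ge0.
  rewrite gB; apply: le_trans ((dominated_P Pp).2 _) _.
  apply: le_trans (seminormB VT dN.1 _ _) _ => //.
  apply: (@le_trans _ _ ((M + 1) * N (v s - v s'))).
    by rewrite mulrDl mul1r lerD2r semigroup_norm_le.
  rewrite -mulrA ler_wpM2l ?addr_ge0//.
  have -> : v s - v s' = (T s x - T s' x) - sor (s - s') *: z.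
    by rewrite /v rmorphB scalerBl opprD !opprK addrACA opprB [- _ + _]addrC.
  apply: le_trans (seminormB VT dN.1 _ _) _ => //; rewrite mulrDl.
  by rewrite (seminormZr dN.1)// (ger0_norm ss'0) [N z * _]mulrC lerD2r hC.
move=> s e /andP[s0 st] e0.
have sh0 : 0 <= h + s by rewrite addr_ge0.
have e20 : 0 < e / 2 by lra.
have eE (r : R) : e / 2 * r + e / 2 * r + K * r = (K + e) * r by lra.
near=> r.
have r0 : 0 < r by near: r; exact: nbhs_right_gt.
have h1 : p (T (s + r) x - T s x - sor r *: T s y) <= e / 2 * r.
  by near: r; exact: gen_derivative.
have h2 : p (T (h + s + r) x - T (h + s) x - sor r *: T (h + s) y) <= e / 2 * r.
  by near: r; exact: gen_derivative.
set b := T (s + r) x - T s x - sor r *: T s y in h1.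
(* T h maps the remainder at s to the remainder at h + s, which is small by [gen_derivative]; no
   continuity of T h is involved. *)
have Thb : T h b = T (h + s + r) x - T (h + s) x - sor r *: T (h + s) y.
  by rewrite /b !semigroupB// semigroupZ// -!semigroup_add ?addrA// ?addr_ge0// ltW.
have vE : v (s + r) - v s = b + sor r *: (T s y - z).
  rewrite /v /b rmorphD scalerDl scalerBr [RHS]addrA subrK.
  by rewrite opprB addrA [sor s *: z + _]addrC opprD addrA subrK addrAC.
rewrite gB vE semigroupD// semigroupZ//.
rewrite [X in p X](_ : _ = T h b - b + sor r *: (T h (T s y - z) - (T s y - z))); last first.
  by rewrite opprD addrACA -scalerBr.
apply: le_trans (seminormD psn _ _) _ => //; rewrite -eE; apply: lerD.
  by apply: le_trans (seminormB VT psn _ _) _ => //; rewrite Thb lerD.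
rewrite (seminormZr psn)// gtr0_norm// mulrC ler_wpM2r ?(ltW r0)//.
by apply: hK; rewrite s0 ltW.
Unshelve. all: by end_near. Qed.

(** The mean value inequality shows that T h fixes T t x - x. The fixed-vector argument is therefore
    used twice, for T t x - x and then for x. *)
Lemma gen_inj0 x : gen_dom X T x -> gen X T x = 0 -> x = 0.
Proof.
move=> Dx Ax0; have hy := gen_dom_value Dx; rewrite Ax0 in hy.
apply: semigroup_inj0 => t t0; apply/eqP; rewrite -subr_eq0; apply/eqP.
apply: semigroup_inj0 => h h0; apply/eqP; rewrite -subr_eq0; apply/eqP.
apply: P_separates => p Pp; apply/eqP; have psn := (dominated_P Pp).1.
rewrite eq_le (seminorm_ge0 psn)// andbT.
have := @gen_mean_value x 0 0 p h t 0 Dx hy Pp (ltW h0) (ltW t0).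
rewrite scaler0 subr0 mul0r; apply => s /andP[s0 _].
by rewrite semigroup0// subrr (semigroup0 (ltW h0)) subrr (seminorm0 VT psn).
Qed.

(** * The generator on X_alpha as a part of A *)

Lemma holder_gen_value x y C : Xs x ->
  (forall t, 0 < t <= 1 -> H N (T t x - x) <= C * t) ->
  is_gen_value Xa T x y -> is_gen_value X T x y.
Proof.
move=> Xx hC [Xy hy]; apply/is_gen_valueP => p Pp e e0.
have XT t : 0 < t -> Xs (sor t^-1 *: (T t x - x)).
  move=> t0; apply: (subspaceZ subspace_X); apply: (subspaceB subspace_X) => //.
  exact: semigroup_X_space (ltW t0) Xx.
have nX : \forall t \near 0^'+, Xs (sor t^-1 *: (T t x - x)).
  by near=> t; apply: XT; near: t; exact: nbhs_right_gt.
(* The passage from tau_F to tau takes place on a norm-bounded set: C bounds the difference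
   quotients for t <= 1, and [H N y] accounts for the subtracted y. *)
have [d d0 hd] := seminorm_lt_holder (C + H N y) e0.
move/(cvg_holderP _ Xy nX) : hy => /(_ p Pp d d0) hp.
near=> t.
have t0 : 0 < t by near: t; exact: nbhs_right_gt.
have t1 : t <= 1 by near: t; apply: nbhs_right_le; exact: ltr01.
have FT := X_space_F (XT t t0).
apply: hd => //; [exact: (subspaceB subspace_F FT (X_space_F Xy))| |by near: t].
apply: le_trans (seminormB subspace_F (holder_seminorm_on dN) FT (X_space_F Xy)) _.
rewrite lerD2r (seminormZr (holder_seminorm_on dN)); last first.
  exact: X_space_F (subspaceB subspace_X (semigroup_X_space (ltW t0) Xx) Xx).
by rewrite gtr0_norm ?invr_gt0// ler_pdivrMl// mulrC hC// t0.
Unshelve. all: by end_near. Qed.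

Lemma holder_gen_domP x : gen_dom Xa T x <->
  [/\ Xs x, exists y, is_gen_value Xa T x y &
      exists C, forall t, 0 < t <= 1 -> H N (T t x - x) <= C * t].
Proof.
split=> [[? ? /(ereal_sup_quotient_lty (fun t => H N (T t x - x)))]|[? ? ?]] //.
by split => //; exact/(ereal_sup_quotient_lty (fun t => H N (T t x - x))).
Qed.

Lemma holder_gen_dom_sub x : gen_dom Xa T x ->
  [/\ gen_dom X T x, Xs x, Xs (gen X T x) & gen Xa T x = gen X T x].
Proof.
move=> /holder_gen_domP[Xx [y hy] [C hC]].
have hy' := holder_gen_value Xx hC hy.
have gE : gen X T x = y := gen_eq hy'.
split => //.
- apply/gen_domP; split; first by exists y.
  have [C' C'0 hC'] := norm_le_holder; exists (C' * C) => t t01.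
  have t0 : 0 <= t by case/andP: t01 => /ltW.
  apply: le_trans (hC' _ _) _.
    exact: X_space_F (subspaceB subspace_X (semigroup_X_space t0 Xx) Xx).
  by rewrite -mulrA ler_wpM2l ?(ltW C'0)// hC.
- by rewrite gE; case: hy.
- rewrite gE; apply: (is_gen_value_unique _ hy'); apply: (holder_gen_value Xx hC).
  by apply: (@xgetPex _ 0 (is_gen_value Xa T x)); exists y.
Qed.

Lemma holder_gen_dom_sup x : gen_dom X T x -> Xs x -> Xs (gen X T x) -> gen_dom Xa T x.
Proof.
move=> Dx Xx; have hy := gen_dom_value Dx; set y := gen X T x in hy * => Xy.
have Fy := X_space_F Xy.
have M0 : 0 <= M by apply: le_trans M1.
have bound t : 0 < t -> H N (T t x - x) <= M * H N y * t.
  (* The derivative is a tau-limit, so the norm bound is obtained from each p separately, with a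
     constant that does not depend on p. *)
  move=> t0; apply: (holder_seminorm_lub dN) => h h0; apply: norm_le_P => p Pp.
  rewrite (holder_quotientE _ (dominated_P Pp) h0) ler_pdivrMr ?powR_gt0// mulrAC.
  have := @gen_mean_value x y 0 p h t (M * H N y * h `^ alpha) Dx hy Pp (ltW h0) (ltW t0).
  rewrite scaler0 subr0; apply => s /andP[s0 _]; rewrite subr0.
  rewrite (holder_quotientK _ (dominated_P Pp) h0) mulrC ler_wpM2r ?powR_ge0//.
  rewrite -(semigroup_holder_quotient _ s0 (ltW h0)).
  apply: le_trans ((dominated_P Pp).2 _) _; apply: le_trans (semigroup_norm_le _ s0) _.
  by rewrite ler_wpM2l//; exact: (holder_seminorm_ub dN Fy h0).
apply/holder_gen_domP; split => //; last first.
  by exists (M * H N y) => t /andP[t0 _]; exact: bound.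
exists y; split => //; apply/cvg_holderP => //.
  near=> t; apply: (subspaceZ subspace_X).
  have t0 : 0 < t by near: t; exact: nbhs_right_gt.
  exact: (subspaceB subspace_X (semigroup_X_space (ltW t0) Xx) Xx).
move=> p Pp e e0; have dp := dominated_P Pp; have psn := dp.1.
have [e20 e2] : 0 < e / 2 /\ e / 2 < e by split; lra.
(* Strong continuity of T on X_alpha at y = A x makes the constant of the mean value inequality with
   z = y small for all h at once. *)
have [d d0 hd] : exists2 d, 0 < d & forall s, 0 <= s -> s < d -> H p (T s y - y) < e / 2.
  have := holder_orbit_cvg Xy (lexx 0) Pp e20.
  rewrite /within /= => /nbhs_ballP[d /= d0 hd]; exists d => // s s0 sd.
  have := hd s; rewrite (bc_zero hT)//; apply => //.
  by rewrite /ball /= sub0r normrN ger0_norm.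
near=> t.
have t0 : 0 < t by near: t; exact: nbhs_right_gt.
have td : t < d by near: t; exact: nbhs_right_lt.
have -> : sor t^-1 *: (T t x - x) - y = sor t^-1 *: (T t x - x - sor t *: y).
  by rewrite [RHS]scalerBr scalerA -rmorphM mulVf ?gt_eqF// rmorph1 scale1r.
apply: le_lt_trans e2; apply: (holder_seminorm_lub dp) => h h0.
rewrite (holder_quotientZ _ _ (ltW h0)) (seminormZr psn)// gtr0_norm ?invr_gt0//.
rewrite ler_pdivrMl// (holder_quotientE _ dp h0) ler_pdivrMr ?powR_gt0//.
rewrite [leRHS](_ : _ = e / 2 * h `^ alpha * t); last first.
  by rewrite mulrC [t * _]mulrC mulrA [_ `^ _ * _]mulrC.
apply: (gen_mean_value Dx hy Pp (ltW h0) (ltW t0)) => s /andP[s0 st].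
rewrite (holder_quotientK _ dp h0) mulrC ler_wpM2r ?powR_ge0//.
apply/ltW; apply: le_lt_trans (hd s s0 (le_lt_trans st td)).
apply: (holder_seminorm_ub dp _ h0).
exact: X_space_F (subspaceB subspace_X (semigroup_X_space s0 Xy) Xy).
Unshelve. all: by end_near. Qed.

(** * The integral of an orbit *)

Definition grid (h s : R) : R := (Num.truncn (s / h))%:R * h.

Lemma grid_ge0 h s : 0 < h -> 0 <= grid h s.
Proof. by move=> h0; rewrite mulr_ge0// ltW. Qed.

Lemma grid_itv h s : 0 < h -> 0 <= s -> grid h s <= s < grid h s + h.
Proof.
move=> h0 s0; have /truncn_itv/andP[] : 0 <= s / h by rewrite divr_ge0// ltW.
rewrite ler_pdivlMr// ltr_pdivrMr// -natr1 mulrDl mul1r => h1 h2.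
by apply/andP; split.
Qed.

(** The primitive, zero at 0, of the step function s -> T (grid h s) x: left-endpoint Riemann sums
    interpolated continuously in s. *)
Definition polygon (x : V) (h s : R) : V :=
  \sum_(j < Num.truncn (s / h)) sor h *: T (j%:R * h) x +
  sor (s - grid h s) *: T (grid h s) x.

(** The cell is closed on the right although [truncn] jumps there; both formulas agree at the node,
    which gives access to increments on its left. *)
Lemma polygon_cell x h (m : nat) s : 0 < h -> m%:R * h <= s <= m.+1%:R * h ->
  polygon x h s =
  \sum_(j < m) sor h *: T (j%:R * h) x + sor (s - m%:R * h) *: T (m%:R * h) x.
Proof.
move=> h0 /andP[ms]; rewrite le_eqVlt => /orP[/eqP ->|sm].
  have tE : Num.truncn (m.+1%:R * h / h) = m.+1 by rewrite mulfK ?gt_eqF// natrK.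
  rewrite /polygon /grid tE subrr rmorph0 scale0r addr0 big_ord_recr /=.
  by rewrite -natr1 mulrDl mul1r [_ + h - _]addrAC subrr add0r.
have tE : Num.truncn (s / h) = m.
  by apply: truncn_def; rewrite ler_pdivlMr// ltr_pdivrMr// ms.
by rewrite /polygon /grid tE.
Qed.

(** A local description without a partition, so that differences of polygons with different meshes
    are again of this kind. The slope matters on the right only; on the left any z ensures
    continuity. *)
Definition piecewise_affine (G u : R -> V) : Prop :=
  (forall s, 0 <= s -> \forall r \near 0^'+, G (s + r) - G s = sor r *: u s) /\
  (forall s, 0 < s -> exists z, exists2 d, 0 < d & forall s', 0 <= s' ->
     s - d < s' <= s -> G s - G s' = sor (s - s') *: z).

Lemma piecewise_affine_linear z : piecewise_affine (fun s => sor s *: z) (fun=> z).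
Proof.
split=> [s s0|s s0].
  by apply: nearW => r; rewrite -scalerBl -rmorphB addrAC subrr add0r.
by exists z, 1 => // s' _ _; rewrite -scalerBl -rmorphB.
Qed.

Lemma piecewise_affineB G u G' u' : piecewise_affine G u -> piecewise_affine G' u' ->
  piecewise_affine (fun s => G s - G' s) (fun s => u s - u' s).
Proof.
move=> [Gr Gl] [Gr' Gl']; split=> s s0.
  apply: filterS (filterI (Gr s s0) (Gr' s s0)) => r [h1 h2].
  by rewrite scalerBr -h1 -h2 !opprB addrACA [RHS]addrACA [- G s + _]addrC.
have [z [d d0 hd]] := Gl s s0; have [z' [d' d'0 hd']] := Gl' s s0.
exists (z - z'), (Num.min d d'); first by rewrite lt_min d0.
move=> s' s'0 /andP[ss' s's]; rewrite scalerBr -hd -?hd' //.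
- by rewrite !opprB addrACA [RHS]addrACA [- G' s + _]addrC.
- by rewrite s's andbT (le_lt_trans _ ss')// lerD2l lerN2 ge_min lexx orbT.
- by rewrite s's andbT (le_lt_trans _ ss')// lerD2l lerN2 ge_min lexx.
Qed.

Lemma piecewise_affine_mean_value p G u K a b : seminorm_on setT p ->
  piecewise_affine G u -> 0 <= a -> a <= b ->
  (forall s, a <= s <= b -> p (u s) <= K) -> p (G b - G a) <= K * (b - a).
Proof.
move=> psn [Gr Gl] a0 ab hK; have ab0 : 0 <= b - a by rewrite subr_ge0.
have := @seminorm_mean_value _ _ _ p (fun s => G (a + s)) K (b - a) psn ab0.
rewrite /= addr0 [a + (b - a)]addrC subrK; apply.
  move=> s e /andP[s0 sba] e0; have as0 : 0 < a + s by rewrite ltr_wpDl.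
  have [z [d d0 hd]] := Gl _ as0.
  have pz := seminorm_ge0 psn (x := z) I.
  have pz1 : 0 < p z + 1 by rewrite ltr_wpDl.
  exists (Num.min d (e / (p z + 1))); first by rewrite lt_min d0 divr_gt0.
  move=> s' s'0 /andP[ss' s's].
  have [d1 d2] : s - s' < d /\ s - s' < e / (p z + 1).
    by move: ss'; rewrite ltrBlDr -ltrBlDl lt_min => /andP[].
  rewrite hd ?addr_ge0//; last first.
    by rewrite lerD2l s's andbT -addrA ltrD2l ltrBlDr -ltrBlDl.
  rewrite (seminormZr psn)// opprD addrACA subrr add0r ger0_norm ?subr_ge0//.
  apply: (@le_trans _ _ (e / (p z + 1) * (p z + 1))); last by rewrite divfK// gt_eqF.
  by apply: ler_pM; rewrite ?subr_ge0 ?lerDl// ltW.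
move=> s e /andP[s0 sba] e0; have as0 : 0 <= a + s by rewrite addr_ge0.
near=> r; have r0 : 0 < r by near: r; exact: nbhs_right_gt.
rewrite addrA (_ : G (a + s + r) - G (a + s) = sor r *: u (a + s)); last first.
  by near: r; exact: Gr.
rewrite (seminormZr psn)// gtr0_norm// mulrC ler_pM2r//.
apply: (@le_trans _ _ K); last by rewrite lerDl ltW.
by apply: hK; rewrite lerDl s0 -lerBrDl ltW.
Unshelve. all: by end_near. Qed.

Lemma piecewise_affine_polygon x h : 0 < h ->
  piecewise_affine (polygon x h) (fun s => T (grid h s) x).
Proof.
move=> h0; have cellB (m : nat) s s' : m%:R * h <= s <= m.+1%:R * h ->
    m%:R * h <= s' <= m.+1%:R * h ->
    polygon x h s - polygon x h s' = sor (s - s') *: T (m%:R * h) x.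
  move=> sm s'm; rewrite (polygon_cell x h0 sm) (polygon_cell x h0 s'm).
  by rewrite opprD addrACA subrr add0r -scalerBl -rmorphB opprB addrA subrK.
split=> s s0.
  have /andP[g1 g2] := grid_itv h0 s0.
  near=> r; have r0 : 0 < r by near: r; exact: nbhs_right_gt.
  have rlt : r < grid h s + h - s by near: r; apply: nbhs_right_lt; rewrite subr_gt0.
  rewrite (cellB (Num.truncn (s / h))); first by rewrite addrAC subrr add0r.
    rewrite -natr1 mulrDl mul1r -/(grid h s) (le_trans g1) ?lerDl ?ltW//=.
    by rewrite -ltrBrDl.
  by rewrite -natr1 mulrDl mul1r -/(grid h s) g1 ltW.
have /andP[g1 g2] := grid_itv h0 (ltW s0).
have [gs|sg] := ltP (grid h s) s.
  exists (T (grid h s) x), (s - grid h s); first by rewrite subr_gt0.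
  move=> s' s'0; rewrite subKr => /andP[gs' s's].
  rewrite (cellB (Num.truncn (s / h))) // -natr1 mulrDl mul1r -/(grid h s).
    by rewrite g1 ltW.
  by rewrite ltW// (le_trans s's)// ltW.
(* Now s is a node. The slope on its left belongs to the preceding cell, which exists because s >
   0. *)
have sE : s = grid h s by apply/eqP; rewrite eq_le sg g1.
have [m mE] : exists m, Num.truncn (s / h) = m.+1.
  case E : (Num.truncn (s / h)) => [|m]; last by exists m.
  by move: s0; rewrite sE /grid E mul0r ltxx.
have {}sE : s = m.+1%:R * h by rewrite sE /grid mE.
have mh : m%:R * h <= m.+1%:R * h by rewrite ler_pM2r// ler_nat.
exists (T (m%:R * h) x), h => // s' s'0 /andP[ss' s's].
have mE' : s - h = m%:R * h by rewrite sE -natr1 mulrDl mul1r addrK.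
apply: cellB; first by rewrite sE mh lexx.
by rewrite -mE' (ltW ss') -sE.
Unshelve. all: by end_near. Qed.

(** Uniformity on [0, t] follows from T s x - T g x = T g (T (s - g) x - x) with g = [grid h s]:
    continuity at 0 alone is used, transported by equicontinuity. *)
Lemma grid_cvg x p t e : P p -> 0 <= t -> 0 < e -> exists2 d, 0 < d &
  forall h, 0 < h < d -> forall s, 0 <= s <= t -> p (T (grid h s) x - T s x) <= e.
Proof.
move=> Pp t0 e0; have psn := (dominated_P Pp).1.
have FF : Filter (0 : R)^'+ by typeclasses eauto.
have := @equicontinuous _ (0 : R)^'+ (fun r => T r x - x) (M * N x + N x) FF
  (countably_based_right0 R) _ _ p t e Pp t0 e0.
case.
- near=> r; apply: le_trans (seminormB VT dN.1 _ _) _ => //; rewrite lerD2r.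
  by apply: semigroup_norm_le; apply: ltW; near: r; exact: nbhs_right_gt.
- move=> q Pq d d0; have := semigroup_cvg x (lexx 0) Pq d0.
  rewrite (bc_zero hT)// => h.
  change (nbhs (0 : R) (fun r => 0 < r -> q (T r x - x) < d)).
  change (nbhs (0 : R) (fun r => 0 <= r -> q (T r x - x) < d)) in h.
  by apply: filterS h => r h /ltW /h.
move=> d /= d0 hd; exists d => // h /andP[h0 hlt] s /andP[s0 st].
have /andP[g1 g2] := grid_itv h0 s0.
have [->|gn] := eqVneq (grid h s) s; first by rewrite subrr (seminorm0 VT psn) ltW.
have gs : 0 < s - grid h s by rewrite subr_gt0 lt_def eq_sym gn.
rewrite (seminormBC VT psn)//.
have -> : T s x - T (grid h s) x = T (grid h s) (T (s - grid h s) x - x).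
  by rewrite semigroupB ?grid_ge0// -semigroup_add ?grid_ge0 ?(ltW gs)// [grid h s + _]addrC subrK.
apply/ltW; apply: hd => //; last by rewrite grid_ge0//= (le_trans g1).
rewrite /ball /= sub0r normrN gtr0_norm//; apply: lt_trans hlt.
by rewrite ltrBlDl.
Unshelve. all: by end_near. Qed.

(* Y is the tau-Riemann integral of the orbit of x, obtained as the limit of
   polygons; the mean value inequality gives both the Cauchy property and the
   estimate for the limit. *)
Lemma orbit_antiderivative x : exists Y : R -> V,
  forall p a b z K, P p -> 0 <= a -> a <= b ->
    (forall s, a <= s <= b -> p (T s x - z) <= K) ->
    p (Y b - Y a - sor (b - a) *: z) <= K * (b - a).
Proof.
pose h n : R := n.+1%:R^-1.
have h0 n : 0 < h n by rewrite invr_gt0.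
pose G n := polygon x (h n).
have G0 n : G n 0 = 0.
  have := @polygon_cell x (h n) 0 0 (h0 n).
  by rewrite mul0r lexx mul1r (ltW (h0 n)) big_ord0 subr0 rmorph0 scale0r addr0; apply.
(* The guard on t sits under the existential so that [choice] returns a total function, with a
   default value at negative times. *)
have lim t : exists l, 0 <= t -> forall p, P p -> forall e, 0 < e ->
    \forall n \near \oo, p (G n t - l) < e.
  have [t0|] := leP 0 t; last by exists 0.
  have [|p Pp e e0|l hl] := @tau_complete_bounded (G^~ t) (M * N x * t); last by exists l.
    move=> n; have := @piecewise_affine_mean_value N (G n) _ (M * N x) 0 t dN.1
      (piecewise_affine_polygon x (h0 n)) (lexx 0) t0.
    by rewrite G0 !subr0; apply => s _; apply: semigroup_norm_le; exact: grid_ge0.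
  have psn := (dominated_P Pp).1.
  (* Both step functions stay within e' of the orbit on [0, t], so the two polygons differ at t by
     at most 2 e' t < e. *)
  pose e' := e / 2 / (t + 1).
  have t1 : 0 < t + 1 by rewrite ltr_wpDl.
  have e'0 : 0 < e' by rewrite !divr_gt0.
  have e't : (e' + e') * t < e.
    have -> : e' + e' = e / (t + 1) by rewrite /e' -mulrDl -splitr.
    by rewrite mulrAC ltr_pdivrMr// ltr_pM2l// ltrDl.
  have [d d0 hd] := grid_cvg x Pp t0 e'0.
  have [n0 hn0] := near_invSn d0; exists n0 => m n nm nn.
  apply: le_lt_trans e't.
  have := @piecewise_affine_mean_value p _ _ (e' + e') 0 t psn
    (piecewise_affineB (piecewise_affine_polygon x (h0 m)) (piecewise_affine_polygon x (h0 n)))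
    (lexx 0) t0.
  rewrite -/(G m) -/(G n) !G0 !subr0; apply => s st.
  apply: le_trans (seminorm_tri VT psn (z := T s x) _ _ _) _ => //.
  rewrite [X in _ + X](seminormBC VT psn)//; apply: lerD; apply: hd => //.
    by rewrite h0 hn0.
  by rewrite h0 hn0.
have [Y hY] := choice lim; exists Y => p a b z K Pp a0 ab hK.
have psn := (dominated_P Pp).1; have b0 : 0 <= b := le_trans a0 ab.
have ba1 : 0 < b - a + 1 by rewrite ltr_wpDl// subr_ge0.
apply/ler_addgt0Pr => e e0.
pose e' := e / 2 / (b - a + 1).
have e'0 : 0 < e' by rewrite !divr_gt0.
have e'b : e' * (b - a) <= e / 2.
  rewrite /e' mulrAC ler_pdivrMr// ler_pM2l ?divr_gt0//; lra.
have e40 : 0 < e / 4 by rewrite divr_gt0.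
have [d d0 hd] := grid_cvg x Pp b0 e'0.
have [n0 hn0] := near_invSn d0.
have near_n0 : \forall n \near \oo, h n < d by exists n0.
have [n [[h1 h2] h3]] := filter_ex (filterI (filterI (hY a a0 p Pp _ e40)
  (hY b b0 p Pp _ e40)) near_n0).
have h4 : p (G n b - G n a - sor (b - a) *: z) <= (K + e') * (b - a).
  have := @piecewise_affine_mean_value p _ _ (K + e') a b psn
    (piecewise_affineB (piecewise_affine_polygon x (h0 n)) (piecewise_affine_linear z)) a0 ab.
  rewrite -/(G n) opprD addrACA -opprD -scalerBl -rmorphB.
  apply => s /andP[sa sb].
  apply: le_trans (seminorm_tri VT psn (z := T s x) _ _ _) _ => //.
  rewrite addrC; apply: lerD; first by apply: hK; rewrite sa.
  by apply: hd; rewrite ?h0 ?h3 ?sb ?(le_trans a0).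
have -> : Y b - Y a - sor (b - a) *: z =
    (G n a - Y a) - (G n b - Y b) + (G n b - G n a - sor (b - a) *: z).
  rewrite opprB [RHS]addrA; congr (_ + _).
  by rewrite -addrA [Y b - _ + _]addrA subrK [RHS]addrC addrA subrK.
apply: le_trans (seminormD psn _ _) _ => //.
have h5 := seminormB VT psn (x := G n a - Y a) (y := G n b - Y b) I I.
rewrite mulrDl in h4; lra.
Qed.

(** * Range of A and extrapolated density of its domain *)

Lemma gen_dom0 : gen_dom X T 0 /\ gen X T 0 = 0.
Proof.
have hy : is_gen_value X T 0 0.
  apply/is_gen_valueP => p Pp e e0; near=> r.
  have r0 : 0 < r by near: r; exact: nbhs_right_gt.
  by rewrite semigroup0 ?(ltW r0)// !subr0 scaler0 (seminorm0 VT (dominated_P Pp).1).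
split; last exact: gen_eq.
apply/gen_domP; split; first by exists 0.
exists 0 => r /andP[r0 _]; rewrite semigroup0 ?(ltW r0)// subr0 mul0r.
by rewrite (seminorm0 VT dN.1).
Unshelve. all: by end_near. Qed.

Lemma gen_dom_semigroup x t : 0 <= t -> gen_dom X T x -> gen_dom X T (T t x).
Proof.
move=> t0 Dx; have hy := gen_dom_value Dx; have [C C0 hC] := gen_dom_lipschitz Dx.
apply/gen_domP; split; last first.
  exists C => r /andP[/ltW r0 _]; rewrite -semigroup_add// [r + t]addrC.
  by have := hC t (t + r) t0; rewrite lerDl => /(_ r0); rewrite [t + r]addrC addrK.
exists (T t (gen X T x)); apply/is_gen_valueP => p Pp e e0.
have [e20 e2] : 0 < e / 2 /\ e / 2 < e by split; lra.
near=> r; have r0 : 0 < r by near: r; exact: nbhs_right_gt.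
have h : p (T (t + r) x - T t x - sor r *: T t (gen X T x)) <= e / 2 * r.
  by near: r; exact: gen_derivative.
apply: le_lt_trans e2; rewrite -semigroup_add ?(ltW r0)// [r + t]addrC.
have -> : sor r^-1 *: (T (t + r) x - T t x) - T t (gen X T x) =
    sor r^-1 *: (T (t + r) x - T t x - sor r *: T t (gen X T x)).
  by rewrite [RHS]scalerBr scalerA -rmorphM mulVf ?gt_eqF// rmorph1 scale1r.
rewrite (seminormZr (dominated_P Pp).1)// gtr0_norm ?invr_gt0//.
by rewrite ler_pdivrMl// mulrC.
Unshelve. all: by end_near. Qed.

(** The vector y is the integral of the orbit of x over [0, t]. The last clause compares its mean
    with a fixed z, and is used to show that means over short intervals are close to the starting
    point. *)
Lemma gen_antiderivative x t : 0 <= t -> exists y,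
  [/\ gen_dom X T y, gen X T y = T t x - x &
      forall z K, (forall s, 0 <= s <= t -> N (T s x - z) <= K) ->
        N (y - sor t *: z) <= K * t].
Proof.
move=> t0; have [Y hY] := orbit_antiderivative x.
have M0 : 0 <= M by apply: le_trans M1.
pose B := M * N x.
have YN a b z K : 0 <= a -> a <= b -> (forall s, a <= s <= b -> N (T s x - z) <= K) ->
    N (Y b - Y a - sor (b - a) *: z) <= K * (b - a).
  move=> a0 ab hK; apply: norm_le_P => p Pp; apply: (hY p) => // s sab.
  by apply: le_trans (hK s sab); exact: (dominated_P Pp).2.
have Ylip a b : 0 <= a -> a <= b -> N (Y b - Y a) <= B * (b - a).
  move=> a0 ab; have := YN a b 0 B a0 ab; rewrite scaler0 subr0; apply => s /andP[sa _].
  by rewrite subr0; apply: semigroup_norm_le; exact: le_trans sa.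
have Yder p s e : P p -> 0 <= s -> 0 < e ->
    \forall r \near 0^'+, p (Y (s + r) - Y s - sor r *: T s x) <= e * r.
  move=> Pp s0 e0; have := semigroup_cvg x s0 Pp e0.
  rewrite /within /= => /nbhs_ballP[d /= d0 hd]; near=> r.
  have r0 : 0 < r by near: r; exact: nbhs_right_gt.
  have rd : r < d by near: r; exact: nbhs_right_lt.
  have := hY p s (s + r) (T s x) e Pp s0; rewrite lerDl [s + r - s]addrAC subrr add0r.
  apply; first exact: ltW.
  move=> s' /andP[ss' s'r]; apply/ltW/hd; last exact: le_trans ss'.
  rewrite /ball /= distrC ger0_norm ?subr_ge0//.
  by apply: le_lt_trans rd; rewrite lerBlDl.
(* T r is moved inside the integral without exchanging it with the limit of polygons: T r (Y s) - Y
   (s + r) is Lipschitz in s with right derivative 0. Its remainders, divided by h, are bounded by 2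
   B and tau-null, so T r keeps them tau-null. *)
have shift r : 0 <= r -> T r (Y t - Y 0) = Y (t + r) - Y r.
  move=> r0; apply/eqP; rewrite -subr_eq0; apply/eqP; apply: P_separates => p Pp.
  have psn := (dominated_P Pp).1.
  apply/eqP; rewrite eq_le (seminorm_ge0 psn)// andbT.
  pose g s := T r (Y s) - Y (s + r).
  have -> : T r (Y t - Y 0) - (Y (t + r) - Y r) = g t - g 0.
    by rewrite -[Y r](congr1 Y (add0r r)) semigroupB// opprD addrACA -opprD.
  rewrite -[leRHS](mul0r t).
  have gB s s' : g s - g s' = T r (Y s - Y s') - (Y (s + r) - Y (s' + r)).
    by rewrite semigroupB// opprD addrACA -opprD.
  apply: (@seminorm_mean_value_lipschitz _ _ _ p g ((M + 1) * B) 0 t) => //.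
    move=> s s' s'0 s's; rewrite gB.
    apply: le_trans ((dominated_P Pp).2 _) _.
    apply: le_trans (seminormB VT dN.1 _ _) _ => //.
    rewrite mulrDl mul1r mulrDl -mulrA; apply: lerD.
      apply: le_trans (semigroup_norm_le _ r0) _.
      by rewrite ler_wpM2l// Ylip.
    have := Ylip (s' + r) (s + r); rewrite opprD addrACA subrr addr0 lerD2r.
    by apply => //; exact: addr_ge0.
  move=> s e /andP[s0 st] e0; rewrite add0r.
  have [e20 e2] : 0 < e / 2 /\ e / 2 + e / 2 = e by split; lra.
  have sr0 : 0 <= s + r by exact: addr_ge0.
  pose rem h := Y (s + h) - Y s - sor h *: T s x.
  have FF : Filter (0 : R)^'+ by typeclasses eauto.
  have := @equicontinuous _ (0 : R)^'+ (fun h => sor h^-1 *: rem h) (B + B) FF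
    (countably_based_right0 R) _ _ p r (e / 2) Pp r0 e20.
  move=> equi; have {}equi := equi _ _.
  near=> h; have h0 : 0 < h by near: h; exact: nbhs_right_gt.
  have h1 : p (T r (sor h^-1 *: rem h)) < e / 2.
    suff : forall s, 0 <= s <= r -> p (T s (sor h^-1 *: rem h)) < e / 2.
      by apply; rewrite r0 lexx.
    near: h; apply: equi.
      near=> h; have h0 : 0 < h by near: h; exact: nbhs_right_gt.
      rewrite (seminormZr dN.1)// gtr0_norm ?invr_gt0// ler_pdivrMl// mulrC.
      have := YN s (s + h) (T s x) (B + B) s0; rewrite lerDl (ltW h0) => /(_ isT).
      rewrite [s + h - s]addrAC subrr add0r; apply => s' /andP[ss' _].
      apply: le_trans (seminormB VT dN.1 _ _) _ => //.
      by rewrite lerD// semigroup_norm_le// (le_trans s0).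
    move=> q Pq d d0; have [d20 d2] : 0 < d / 2 /\ d / 2 < d by split; lra.
    near=> h; have h0 : 0 < h by near: h; exact: nbhs_right_gt.
    rewrite (seminormZr (dominated_P Pq).1)// gtr0_norm ?invr_gt0//.
    apply: le_lt_trans d2; rewrite ler_pdivrMl// mulrC.
    by near: h; exact: Yder.
  have h2 : p (Y (s + r + h) - Y (s + r) - sor h *: T (s + r) x) <= e / 2 * h.
    by near: h; exact: Yder.
  have -> : g (s + h) - g s =
      sor h *: T r (sor h^-1 *: rem h) - (Y (s + r + h) - Y (s + r) - sor h *: T (s + r) x).
    rewrite gB [s + h + r]addrAC semigroupZ// scalerA -rmorphM divff ?gt_eqF// rmorph1 scale1r.
    rewrite /rem [T r (_ - sor h *: _)]semigroupB// semigroupZ// -semigroup_add// [r + s]addrC.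
    by rewrite [- (_ - sor h *: _)]opprB [RHS]addrA subrK.
  apply: le_trans (seminormB VT psn _ _) _ => //.
  rewrite (seminormZr psn)// gtr0_norm// -e2 mulrDl; apply: lerD => //.
  by rewrite mulrC ler_pM2r// ltW.
have hgen : is_gen_value X T (Y t - Y 0) (T t x - x).
  apply/is_gen_valueP => p Pp e e0; have psn := (dominated_P Pp).1.
  have [e40 [e4 e42]] : 0 < e / 4 /\ (e / 2 < e /\ e / 4 + e / 4 = e / 2).
    by split; [|split]; lra.
  near=> r; have r0 : 0 < r by near: r; exact: nbhs_right_gt.
  have h1 : p (Y (t + r) - Y t - sor r *: T t x) <= e / 4 * r by near: r; exact: Yder.
  have h2 : p (Y (0 + r) - Y 0 - sor r *: T 0 x) <= e / 4 * r by near: r; exact: Yder.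
  rewrite (bc_zero hT)// add0r in h2.
  have -> : sor r^-1 *: (T r (Y t - Y 0) - (Y t - Y 0)) - (T t x - x) =
      sor r^-1 *: ((Y (t + r) - Y t - sor r *: T t x) - (Y r - Y 0 - sor r *: x)).
    rewrite (shift _ (ltW r0)) [X in _ = _ *: X](_ : _ =
      (Y (t + r) - Y r - (Y t - Y 0)) - sor r *: (T t x - x)); last first.
      rewrite scalerBr subrACA; congr (_ - _).
      by rewrite subrACA.
    by rewrite [RHS]scalerBr scalerA -rmorphM mulVf ?gt_eqF// rmorph1 scale1r.
  rewrite (seminormZr psn)// gtr0_norm ?invr_gt0//; apply: le_lt_trans e4.
  rewrite ler_pdivrMl// mulrC -e42 mulrDl.
  by apply: le_trans (seminormB VT psn _ _) _ => //; rewrite lerD.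
exists (Y t - Y 0); split; last 1 first.
- move=> z K hK; have := YN 0 t z K (lexx _) t0 hK; by rewrite subr0.
- apply/gen_domP; split; first by exists (T t x - x).
  exists (B + B) => r /andP[r0 _]; rewrite (shift _ (ltW r0)).
  rewrite opprD addrACA -opprD; apply: le_trans (seminormB VT dN.1 _ _) _ => //.
  rewrite mulrDl; apply: lerD.
    by have := Ylip t (t + r) t0; rewrite lerDl [t + r - t]addrAC subrr add0r; apply; exact: ltW.
  by have := Ylip 0 r (lexx _) (ltW r0); rewrite subr0.
- exact: gen_eq.
Unshelve. all: by end_near. Qed.

(** As A maps the integral of the orbit of w' over [0, t] to T t w' - w', it suffices to solve (1 -
    T t) w' = x. For t large T t halves norms, and z collects the partial sums of the Neumann
    series. *)
Lemma gen_surjective x : exists2 y, gen_dom X T y & gen X T y = x.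
Proof.
have e0 : (0 : R) < 1 / 2 by lra.
have [t t0 ht] := semigroup_decay e0.
have {}ht y : N (T t y) <= N y / 2 by rewrite mulrC -[_^-1]div1r; exact: ht.
pose z n := iter n (fun y => x + T t y) 0.
have zS n : z n.+1 = x + T t (z n) by [].
have zb m : N (z m) <= 2 * N x.
  elim: m => [|m IH]; first by rewrite /z /= (seminorm0 VT dN.1) mulr_ge0// norm_ge0.
  rewrite zS; apply: le_trans (seminormD dN.1 _ _) _ => //.
  by have := ht (z m); lra.
(* The geometric rate 2^-n is weakened to 1 / (n + 1) to match [near_invSn]. *)
have zd n m : N (z (n + m)%N - z n) <= 2 * N x * n.+1%:R^-1.
  have : N (z (n + m)%N - z n) <= 2 * N x * (1 / 2) ^+ n.
    elim: n => [|n IH]; first by rewrite add0n expr0 mulr1 /= subr0.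
    rewrite addSn !zS opprD addrACA subrr add0r -semigroupB ?(ltW t0)//.
    by apply: le_trans (ht _) _; rewrite exprS; lra.
  move=> /le_trans; apply; rewrite ler_wpM2l ?mulr_ge0 ?norm_ge0//.
  rewrite -[leLHS]invrK lef_pV2 ?posrE ?invr_gt0 ?exprn_gt0// -exprVn div1r invrK.
  by rewrite -natrX ler_nat ltn_expl.
have [|w' _ hw] := S_banach hS (u := z) (fun=> I).
  (* Two deviations from z n0, each with factor 2 N x; the summand 1 makes the denominator
     positive. *)
  move=> e e0'; have Nx1 : 0 < 4 * N x + 1 by have := norm_ge0 x; lra.
  have [n0 hn0] := near_invSn (divr_gt0 e0' Nx1).
  exists n0 => m n nm nn /=.
  have h1 := zd n0 (m - n0)%N; have h2 := zd n0 (n - n0)%N; rewrite !subnKC// in h1 h2.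
  have h3 := seminorm_tri VT dN.1 (x := z m) (y := z n) (z := z n0) I I I.
  rewrite (seminormBC VT dN.1 (x := z n0) (y := z n))// in h3.
  have h4 := hn0 n0 (leqnn _); rewrite ltr_pdivlMr// in h4.
  have h5 : 0 < n0.+1%:R^-1 :> R by rewrite invr_gt0.
  move: h1 h2 h4 h5; move: (n0.+1%:R^-1 : R) => q h1 h2 h4 h5; nra.
have w'E : w' = x + T t w'.
  apply/eqP; rewrite -subr_eq0; apply/eqP; apply: norm_eq0; apply/eqP.
  rewrite eq_le norm_ge0 andbT; apply/ler_addgt0Pr => e e0'; rewrite add0r.
  have e20 : 0 < e / 2 by lra.
  have hw1 := (cvgr0Pnorm_lt _).1 hw _ e20.
  have [n0 _ hn0] := hw1.
  have hN n : (n0 <= n)%N -> N (z n - w') < e / 2.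
    by move=> /hn0 /=; rewrite ger0_norm ?norm_ge0.
  have h1 := hN _ (leqnn _); have h2 := hN _ (leqnSn _); rewrite zS in h2.
  have h3 := seminorm_tri VT dN.1 (x := w') (y := x + T t w') (z := x + T t (z n0)) I I I.
  rewrite (seminormBC VT dN.1 (x := w') (y := x + T t (z n0)))// in h3.
  have E : x + T t (z n0) - (x + T t w') = T t (z n0 - w').
    by rewrite semigroupB ?(ltW t0)// opprD addrACA subrr add0r.
  rewrite E in h3.
  have := ht (z n0 - w'); lra.
have [y [Dy Ay _]] := gen_antiderivative w' (ltW t0).
have [D0 A0] := gen_dom0.
have [Dy' Ay'] := gen_dom_linear (-1) Dy D0.
exists (-1 *: y + 0) => //; rewrite Ay' Ay A0 addr0 scaleN1r opprB.
by rewrite {1}w'E addrK.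
Qed.

(* (T t y - y) / t is the image under A of the mean of the orbit of y over [0, t]. *)
Lemma gen_dom_extrapolated_dense x e : 0 < e -> exists d v,
  [/\ gen_dom X T d, gen_dom X T v, gen X T v = x - d & N v < e].
Proof.
move=> e0; have [y Dy Ay] := gen_surjective x; have [C C0 hC] := gen_dom_lipschitz Dy.
(* On [0, t] the orbit of y stays within C t < e of y, and so does its mean. *)
pose t := e / (C + 1); have C1 : 0 < C + 1 by rewrite ltr_wpDl.
have t0 : 0 < t by rewrite divr_gt0.
have [v [Dv Av hv]] := gen_antiderivative y (ltW t0).
have [[D0 A0] tt] : (gen_dom X T 0 /\ gen X T 0 = 0) /\ sor t^-1 * sor t = 1.
  by split; [exact: gen_dom0|rewrite -rmorphM mulVf ?gt_eqF// rmorph1].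
have [Ty Tyt] : gen_dom X T (T t y) /\ gen_dom X T (- y + T t y).
  have h := gen_dom_semigroup (ltW t0) Dy; split => //.
  by have [] := gen_dom_linear (-1) Dy h; rewrite scaleN1r.
exists (sor t^-1 *: (T t y - y)), (y - sor t^-1 *: v); split.
- rewrite -[_ *: _]addr0 [T t y - y]addrC.
  exact: (gen_dom_linear _ Tyt D0).1.
- by rewrite addrC -scaleNr; exact: (gen_dom_linear _ Dv Dy).1.
- by rewrite addrC -scaleNr (gen_dom_linear _ Dv Dy).2 Ay Av addrC scaleNr.
- have -> : y - sor t^-1 *: v = sor (- t^-1) *: (v - sor t *: y).
    by rewrite rmorphN scaleNr scalerBr scalerA tt scale1r opprB.
  rewrite (seminormZr dN.1)// normrN gtr0_norm ?invr_gt0// ltr_pdivrMl//.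
  apply: (@le_lt_trans _ _ (C * t * t)).
    apply: hv => s /andP[s0 st]; have := hC 0 s (lexx _) s0.
    rewrite (bc_zero hT)// subr0 => /le_trans; apply.
    by rewrite ler_wpM2l.
  rewrite mulrC ltr_pM2l// /t mulrA ltr_pdivrMr// mulrC ltr_pM2l//.
  by rewrite ltrDl.
Qed.

End Semigroup.

(** * Extrapolation spaces *)

Section ExtrapolationTheory.
Variables (R : realType) (k : scalar_kind).
Local Notation K := (scalars R k).
Variables (X0 : completeNormedModType K) (D : set X0) (A : X0 -> X0).
Hypothesis D0 : D 0.
Hypothesis Dlin : forall a x y, D x -> D y ->
  D (a *: x + y) /\ A (a *: x + y) = a *: A x + A y.
Hypothesis Ainj0 : forall x, D x -> A x = 0 -> x = 0.
(* Density of D for the norm ||A^-1 x||. *)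
Hypothesis Adense : forall x (e : R), 0 < e -> exists d v,
  [/\ D d, D v, A v = x - d & real_norm v < e].
Variable E : extrapolation D A.

Let DB x y : D x -> D y -> D (x - y) /\ A (x - y) = A x - A y.
Proof. by move=> Dx Dy; have := Dlin (-1) Dy Dx; rewrite !scaleN1r ![- _ + _]addrC. Qed.

Let Ainj : {in D &, injective A}.
Proof.
move=> x y /set_mem Dx /set_mem Dy Axy; have [Dxy Axy'] := DB Dx Dy.
apply/eqP; rewrite -subr_eq0; apply/eqP/Ainj0 => //.
by rewrite Axy' Axy subrr.
Qed.

Lemma norm_ext_j1_A v : D v -> `|ext_j1 E (A v)| = `|v|.
Proof. by move=> Dv; rewrite ext_j1_norm pinvKV ?inE. Qed.

Lemma ext_j1_dom_dense (u : ext1 E) (e : K) : 0 < e ->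
  exists2 d, D d & `|u - ext_j1 E d| < e.
Proof.
move=> e0; have e20 : 0 < e / 2 by rewrite divr_gt0.
have ne : ball u (e / 2) !=set0 by exists u; exact: ballxx.
have [v' [ux [x _ jx]]] := @ext_j1_dense _ _ _ _ _ E (ball u (e / 2)) ne (ball_open u _).
have e2r : 0 < real_part (e / 2).
  by rewrite -(ltr_scalar_of_real k) rmorph0 scalar_of_realK// ltW.
have [d [v [Dd Dv Av Nv]]] := Adense x e2r.
exists d => //; rewrite (splitr e) -(subrK (ext_j1 E x) u) -addrA.
apply: le_lt_trans (ler_normD _ _) _; apply: ltrD.
  by move: ux; rewrite -ball_normE /= jx.
rewrite -linearB -Av norm_ext_j1_A// normr_real_norm.
by rewrite -(scalar_of_realK (ltW e20)) ltr_scalar_of_real.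
Qed.

Lemma ext_j1_dom_eq (W : normedModType K) (f g : ext1 E -> W) :
  continuous f -> continuous g ->
  (forall d, D d -> f (ext_j1 E d) = g (ext_j1 E d)) -> f =1 g.
Proof.
move=> fc gc fg u; apply/eqP; rewrite -subr_eq0 -normr_le0; apply/negPn/negP => n0.
have e0 : 0 < `|f u - g u| / 2.
  by rewrite divr_gt0// lt_def normr_ge0 andbT; apply: contra n0 => /eqP ->.
have := fc u; have := gc u.
move=> /cvgrPdist_lt/(_ _ e0) hg /cvgrPdist_lt/(_ _ e0) hf.
have : \forall y \near u, `|f u - f y| < `|f u - g u| / 2 /\
    `|g u - g y| < `|f u - g u| / 2 by exact: filterI hf hg.
move=> /nbhs_ballP[d /= d0 hd].
have [x Dx xu] := ext_j1_dom_dense u d0.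
have [] := hd (ext_j1 E x); first by rewrite -ball_normE.
move=> h1 h2; suff : `|f u - g u| < `|f u - g u| by rewrite ltxx.
rewrite [ltRHS]splitr.
have fgE : f u - g u = (f u - f (ext_j1 E x)) - (g u - g (ext_j1 E x)).
  by rewrite opprD addrACA -opprD fg// subrr subr0.
by rewrite [in ltLHS]fgE; apply: le_lt_trans (ler_normB _ _) _; exact: ltrD.
Qed.

(** Approximates w by points of D, on which [ext_A1] preserves distances. This identifies the value
    of the pseudo-inverse on closure D that defines the norm of [ext2]. *)
Lemma ext_A1_isometry w x : closure D w -> D x -> ext_A1 E w = ext_A1 E x -> w = x.
Proof.
move=> Dw Dx wx; apply/eqP; rewrite -subr_eq0 -normr_le0; apply/negPn/negP => n0.
have e0 : 0 < `|w - x| / 2.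
  by rewrite divr_gt0// lt_def normr_ge0 andbT; apply: contra n0 => /eqP ->.
have /subspace_continuousP/(_ w Dw)/cvgrPdist_lt/(_ _ e0) := @ext_A1_continuous _ _ _ _ _ E.
move=> hA; have {}hA : nbhs w (fun y => closure D y ->
  `|ext_A1 E w - ext_A1 E y| < `|w - x| / 2) := hA.
have [w' [Dw' [h1 h2]]] := Dw _ (filterI hA (nbhsx_ballx w _ e0)).
have {}h1 := h1 (subset_closure Dw').
move: h2; rewrite -ball_normE /= => h2.
have [Dd Ad] := DB Dw' Dx.
have h3 : `|w' - x| = `|ext_A1 E w - ext_A1 E w'|.
  by rewrite [RHS]distrC wx !ext_A1_extends// -linearB -Ad norm_ext_j1_A.
suff : `|w - x| < `|w - x| by rewrite ltxx.
have wxE : w - x = (w - w') + (w' - x) by rewrite addrA subrK.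
rewrite [ltRHS]splitr [in ltLHS]wxE; apply: le_lt_trans (ler_normD _ _) _.
by apply: ltrD => //; rewrite h3.
Qed.

Lemma norm_ext_A2 u : `|ext_A2 E u| = `|u|.
Proof.
move: u; apply: (@ext_j1_dom_eq K^o (fun u => `|ext_A2 E u|) (fun u => `|u|)).
- move=> u; apply: continuous_comp; first exact: ext_A2_continuous.
  exact: norm_continuous.
- exact: norm_continuous.
- move=> d Dd /=; have Cd : closure D d by exact: subset_closure.
  rewrite ext_A2_extends// ext_j2_norm; congr (`|ext_j1 E _|).
  have im : (ext_A1 E @` closure D) (ext_A1 E d) by exists d.
  apply: ext_A1_isometry => //; last by rewrite pinvK ?inE.
  apply: (@surjpinv_image_sub _ _ (fun=> 0) (closure D) _ (ext_A1 E)); first by move=> ?; exact.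
  by exists (ext_A1 E d).
Qed.

(** Linearity holds on the dense image of D and extends by continuity in one variable at a time,
    first v and then u. *)
Lemma ext_A2_linear a u v : ext_A2 E (a *: u + v) = a *: ext_A2 E u + ext_A2 E v.
Proof.
have A2d d d' : D d -> D d' -> ext_A2 E (a *: ext_j1 E d + ext_j1 E d') =
    a *: ext_A2 E (ext_j1 E d) + ext_A2 E (ext_j1 E d').
  move=> Dd Dd'; have [Dl Al] := Dlin a Dd Dd'.
  rewrite -linearP !ext_A2_extends; try exact: subset_closure.
  by rewrite !ext_A1_extends// Al !linearP.
have c2 : continuous (ext_A2 E) := @ext_A2_continuous _ _ _ _ _ E.
have half d : D d -> forall v, ext_A2 E (a *: ext_j1 E d + v) =
    a *: ext_A2 E (ext_j1 E d) + ext_A2 E v.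
  move=> Dd; apply: ext_j1_dom_eq; last by move=> d'; exact: A2d.
    move=> z; apply: (@continuous_comp _ _ _ (fun v => a *: ext_j1 E d + v) (ext_A2 E));
      last exact: c2.
    by apply: cvgD; [exact: cvg_cst|exact: cvg_id].
  by move=> z; apply: cvgD; [exact: cvg_cst|exact: c2].
move: u; apply: ext_j1_dom_eq; last by move=> d Dd; exact: half.
  move=> z; apply: (@continuous_comp _ _ _ (fun u => a *: u + v) (ext_A2 E));
    last exact: c2.
  by apply: cvgD; [apply: cvgZr; exact: cvg_id|exact: cvg_cst].
by move=> z; apply: cvgD; [apply: cvgZr; exact: c2|exact: cvg_cst].
Qed.

Lemma A_m1_linear a x y : A_m1 E (a *: x + y) = a *: A_m1 E x + A_m1 E y.
Proof. by rewrite /A_m1 linearP ext_A2_linear. Qed.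

Lemma A_m1B x y : A_m1 E (x - y) = A_m1 E x - A_m1 E y.
Proof. by rewrite addrC -scaleN1r A_m1_linear scaleN1r addrC. Qed.

Lemma A_m1_dom x : D x -> A_m1 E x = ext_incl E (A x).
Proof.
by move=> Dx; rewrite /A_m1 ext_A2_extends ?ext_A1_extends//; exact: subset_closure.
Qed.

Hypothesis Asurj : forall x, exists2 y, D y & A y = x.

(** Writing x - y = A z turns the norm of [ext_j1 E (x - y)] into that of z. This is where
    surjectivity of A makes the embedding injective. *)
Lemma A_m1_inj : injective (A_m1 E).
Proof.
move=> x y /eqP; rewrite -subr_eq0 -A_m1B /A_m1 -normr_eq0 norm_ext_A2 normr_eq0 => /eqP.
have [z Dz Az] := Asurj (x - y); rewrite -Az => /eqP; rewrite -normr_eq0.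
rewrite norm_ext_j1_A// normr_eq0 => /eqP z0.
apply/eqP; rewrite -subr_eq0 -Az z0; apply/eqP.
by have [_] := DB D0 D0; rewrite !subrr.
Qed.

Lemma A_m1K x : A_m1_inv E (A_m1 E x) = x.
Proof. by rewrite /A_m1_inv pinvKV ?inE// => ? ? _ _; exact: A_m1_inj. Qed.

Lemma holder_sup_m1 (T : R -> X0 -> X0) (alpha : R) (q : X0 -> R) x :
  holder_sup (T_m1 E T) alpha (q \o A_m1_inv E) (A_m1 E x) = holder_sup T alpha q x.
Proof.
rewrite /holder_sup; congr ereal_sup; apply: eq_imagel => t _.
by rewrite /T_m1 /= A_m1K -A_m1B A_m1K.
Qed.

Lemma holder_seminorm_m1 (T : R -> X0 -> X0) (alpha : R) (q : X0 -> R) x :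
  holder_seminorm (T_m1 E T) alpha (q \o A_m1_inv E) (A_m1 E x) = holder_seminorm T alpha q x.
Proof. by rewrite /holder_seminorm holder_sup_m1. Qed.

Lemma F_m1_A_m1 (T : R -> X0 -> X0) (alpha : R) tau0 x :
  F_space (Triple setT (@real_norm R k X0) tau0) T alpha x -> F_m1 E T alpha (A_m1 E x).
Proof.
move=> [_ Fx]; split; first by exists x.
by rewrite (holder_sup_m1 T alpha (@real_norm R k X0)).
Qed.

End ExtrapolationTheory.

Unset Implicit Arguments.

Theorem theorem4p20 (R : realType) (k : scalar_kind)
    (X0 : completeNormedModType (scalars R k)) (tau0 : set (set X0))
    (P : set (X0 -> R)) (T : R -> X0 -> X0) (alpha : R) :
  let X := Triple (@setT X0) (@real_norm R k X0) tau0 in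
  let A := gen X T in
  let DA := gen_dom X T in
  let Xalpha := holder_triple X P T alpha in
  let Aalpha := gen Xalpha T in
  let DAalpha := gen_dom Xalpha T in
  assumption_S X ->
  norming_seminorms X P ->
  bicontinuous_semigroup X T ->
  negative_growth_bound X T ->
  0 < alpha < 1 ->
  [/\ assumption_S Xalpha /\ bicontinuous_semigroup Xalpha T,
      DAalpha = [set x | [/\ DA x, carrier Xalpha x & carrier Xalpha (A x)]],
      forall x, DAalpha x -> Aalpha x = A x
    & forall E : extrapolation DA A,
        (forall x, DAalpha x -> F_m1 E T alpha (ext_incl E (Aalpha x))) /\
        continuous_between DAalpha (tau Xalpha) (tau_F_m1 E P T alpha)
          (fun x => ext_incl E (Aalpha x))].
Proof.
move=> X A DA Xalpha Aalpha DAalpha hS hP hT [M [w [M1 w0 hexp]]] /andP[alpha0 _].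
have sub x (h : DAalpha x) := holder_gen_dom_sub hS hP hT M1 w0 hexp h.
split.
- split; first exact: (holder_assumption_S hS hP hT M1 w0 hexp).
  exact: (holder_bicontinuous hS hP hT M1 w0 hexp).
- apply/seteqP; split=> [x /sub[]//|x [Dx Xx XAx]].
  exact: (holder_gen_dom_sup hS hP hT M1 w0 hexp).
- by move=> x /sub[].
move=> E.
have [D0 _] := gen_dom0 hS hP hT.
have Dlin := gen_dom_linear hS hP hT.
have Ainj := gen_inj0 hS hP hT M1 w0 hexp.
have Adense := gen_dom_extrapolated_dense hS hP hT M1 w0 hexp.
have Asurj := gen_surjective hS hP hT M1 w0 hexp.
have AE x : DAalpha x -> ext_incl E (Aalpha x) = A_m1 E x.
  by move=> /sub[Dx _ _ gE]; rewrite A_m1_dom// /Aalpha gE.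
split=> [x Dx|U [UF Uo]].
  rewrite AE//; apply: (F_m1_A_m1 D0 Dlin Ainj Adense E Asurj (tau0 := tau0)).
  by have [_ /X_space_F] := sub x Dx.
(* [A_m1] maps all of X_alpha into F_(alpha-1) and preserves the Hoelder seminorms, so this preimage
   is open in X_alpha and its trace on the domain is the required set. *)
exists [set x | carrier Xalpha x /\ U (A_m1 E x)]; last first.
  apply/seteqP; split=> x [Dx].
    by move=> /=; rewrite AE// => Ux; have [] := sub x Dx.
  by move=> [_ Ux]; split => //=; rewrite AE.
split=> [x []//|x [Xx Ux]].
have [n [q [e [Pq e0 qU]]]] := Uo _ Ux.
have /choice[p hp] : forall i, exists p, P p /\
    holder_seminorm (T_m1 E T) alpha (p \o A_m1_inv E) = q i.
  by move=> i; have [p Pp <-] := Pq i; exists p.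
exists n, (fun i => holder_seminorm T alpha (p i)), e; split => //.
  by move=> i; exists (p i) => //; exact: (hp i).1.
move=> y Xy hy; split => //; apply: qU => [|i].
  by apply: (F_m1_A_m1 D0 Dlin Ainj Adense E Asurj (tau0 := tau0)); exact: (X_space_F Xy).
by rewrite -(hp i).2 -A_m1B// holder_seminorm_m1.
Qed.
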